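(* Let $\Omega\subset\mathbb R^{n+1}$ be a bounded domain of class $C^2$ with boundary $S=\partial\Omega$ and $\beta\in C^1(S,(0,\pi))$. Let $V\in\mathbf{CV}^m_\beta(\Omega)\cap\mathbf{IV}^m(\overline\Omega)$ with boundary varifold $\Gamma$. Then $V$ is a curvature varifold with boundary $\partial V=\mathbf n\Gamma$ in the sense of Mantegazza (with $U=\mathbb R^{n+1}$). Moreover, the total variation of the boundary measure is $$|\partial V|=|\mathbf n\Gamma|=\Gamma.$$
   Context: Notation: $n\ge2$, $m\in\mathbb N$, $1\le m\le n$. $G(m,n+1)$ is the Grassmannian of unoriented $m$-dimensional linear subspaces of $\mathbb R^{n+1}$, where $P\in G(m,n+1)$ is identified with the matrix $(P_{jk})\in\mathbb R^{(n+1)^2}$ of the orthogonal projection onto $P$; $P(v)$ is the orthogonal projection of $v$ onto $P$. $G_m(U)=U\times G(m,n+1)$. $\nu^S$ is the inward pointing unit normal along $S$. An $m$-varifold on $\overline\Omega$ is a positive Radon measure on $G_m(\overline\Omega)$. $\mathbf{IV}^m(\overline\Omega)$ is the set of integral varifolds $\theta\mathcal H^m\llcorner M\otimes\delta_{T_xM}$ on $\overline\Omega$ ($M$ $m$-rectifiable, $\theta$ positive integer-valued, locally $\mathcal H^m$-integrable on $M$). Capillary bundle: for $x\in S$, $G_{m,\beta}(x)$ is the set of $P\in G(m,n+1)$ with (i) $|P(\nu^S(x))|=\sin\beta(x)$ and (ii) $(P\cap T_xS)\perp P(\nu^S(x))$. $G_{m,\beta}(S)=\{(x,P):x\in S,P\in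 G_{m,\beta}(x)\}$ with the subspace topology of $S\times G(m,n+1)$. For $(x,P)\in G_{m,\beta}(S)$, $\mathbf n(x,P)=P(\nu^S(x))/|P(\nu^S(x))|$. Measures on $G_{m,\beta}(S)$ are regarded as measures on $G_m(\mathbb R^{n+1})$. Conventions: $BL(\mathbb R^{n+1}\times\mathbb R^{n+1},\mathbb R^{n+1})$ denotes bilinear maps; with $\{e_i\}$ the standard basis and $B_{ij}^k=\langle B(e_i,e_j),e_k\rangle$, $D_P\phi\cdot B=\sum_{i,j,k}D_{P^k_j}\phi^i\,B_{ij}^k$, $\mathrm{tr}B=\sum_iB(e_i,e_i)$, $\langle\nabla_x\phi,P\rangle=\sum_{i,j}P_{ij}\partial_{x_i}\phi^j$. Curvature varifolds with capillary boundary: $V\in\mathbf{CV}^m_\beta(\Omega)$ with weak second fundamental form $B$ and boundary varifold $\Gamma$ means: $V$ is an $m$-varifold on $\overline\Omega$, $B\in L^1(V)$ with $B(x,P)\in BL(\mathbb R^{n+1}\times\mathbb R^{n+1},\mathbb R^{n+1})$, $\Gamma$ is a Radon measure on $G_{m,\beta}(S)$, and for every $\phi\in C^1(\mathbb R^{n+1}\times\mathbb R^{(n+1)^2},\mathbb R^{n+1})$: $\int(D_P\phi\cdot B+\langle\mathrm{tr}B,\phi\rangle+\langle\nabla_x\phi,P\rangle)dV(x,P)=-\int_{G_{m,\beta}(S)}\langle\mathbf n(x,P),\phi(x,P)\rangle d\Gamma(x,P)$. Mantegazza's definition: an integral $m$-varifold $V$ in $U\subset\mathbb R^{n+1}$ is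 a curvature varifold with boundary, with weak second fundamental form $B\in L^1_{\rm loc}(V)$, if there exists an $\mathbb R^{n+1}$-valued Radon measure $\partial V$ on $G_m(U)$ such that for all $\phi\in C^1_c(U\times\mathbb R^{(n+1)^2},\mathbb R^{n+1})$: $\int_{G_m(U)}(D_P\phi\cdot B+\langle\mathrm{tr}B,\phi\rangle+\langle\nabla_x\phi,P\rangle)dV(x,P)=-\int_{G_m(U)}\langle\phi(x,P),d\partial V(x,P)\rangle$. *)

(* Defs.v *)
From HB Require Import structures.
From mathcomp Require Import all_boot all_order all_algebra.
From mathcomp Require Import sesquilinear.
From mathcomp Require Import all_classical all_reals all_analysis.

Set Implicit Arguments.
Unset Strict Implicit.
Unset Printing Implicit Defensive.

Import Order.TTheory GRing.Theory Num.Theory.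
Import numFieldNormedType.Exports.

Local Open Scope classical_set_scope.
Local Open Scope ring_scope.

(* The library norm on matrices is the sup norm; the Euclidean structure is
   needed for unit normals, Hausdorff measures and total variations. *)
Definition dot (R : realType) (n : nat) (u v : 'rV[R]_n) : R :=
  \sum_i u 0 i * v 0 i.

Definition enorm (R : realType) (n : nat) (u : 'rV[R]_n) : R :=
  Num.sqrt (dot u u).

Definition basis_vec (R : realType) (n : nat) (i : 'I_n) : 'rV[R]_n :=
  delta_mx 0 i.

Definition frontier (T : topologicalType) (A : set T) : set T :=
  closure A `\` A°.

Notation borel T := (g_sigma_algebraType (@open T)).

(* In finite dimension, continuity of the differential amounts to continuity
   of all directional derivatives. *)
Definition C1_on (R : realType) (V W : normedModType R) (U : set V)
    (f : V -> W) : Prop :=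
  (forall x, U x -> differentiable f x) /\
  (forall v x, U x -> {for x, continuous ('D_v f)}).

Definition C2_on (R : realType) (V W : normedModType R) (U : set V)
    (f : V -> W) : Prop :=
  C1_on U f /\ forall v, C1_on U ('D_v f).

Section domains.
Context (R : realType) (n : nat).
Local Notation E := 'rV[R]_n.+1.
Implicit Types (Omega S U : set E) (x : E).

Definition grad (rho : E -> R) x : E := \row_i 'D_(@basis_vec R n.+1 i) rho x.

Definition C2_defining Omega x U (rho : E -> R) : Prop :=
  [/\ open U, U x, C2_on U rho,
      forall y, U y -> (Omega y <-> 0 < rho y) &
      forall y, U y -> grad rho y <> 0].

Definition C2_domain Omega : Prop :=
  [/\ open Omega, connected Omega, Omega !=set0 &
      forall x, frontier Omega x -> exists U rho, C2_defining Omega x U rho].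

(* Since Omega is locally {rho > 0}, the gradient of rho points inward. *)
Definition is_inner_normal Omega x (v : E) : Prop :=
  exists U rho, C2_defining Omega x U rho /\
                v = (enorm (grad rho x))^-1 *: grad rho x.

Definition inner_normal Omega x : E := get (is_inner_normal Omega x).

Definition tangent_space Omega x : set E :=
  [set w | dot w (inner_normal Omega x) = 0].

(* f is C^1 on the hypersurface S: locally it extends to a C^1 function of the
   ambient space. *)
Definition C1_hypersurface S (f : E -> R) : Prop :=
  forall x, S x -> exists U (g : E -> R),
    [/\ open U, U x, C1_on U g & forall y, S y -> U y -> g y = f y].

End domains.

Section hausdorff.
Context (R : realType) (n : nat) (m : nat).
Local Notation E := 'rV[R]_n.+1.
Local Open Scope ereal_scope.
Implicit Types A C : set E.

(* omega_k = 2 pi / k * omega_(k-2) *)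
Fixpoint unit_ball_volume (k : nat) : R :=
  match k with
  | 0%N => 1%R
  | 1%N => 2%R
  | k'.+2 => (2 * pi / k%:R * unit_ball_volume k')%R
  end.

Lemma unit_ball_volume_ge0 k : (0 <= unit_ball_volume k)%R.
Proof.
have [b bk] := ubnP k; elim: b => // b IH in k bk *.
case: k bk => [|[|k]] //= bk.
rewrite mulr_ge0 ?divr_ge0 ?mulr_ge0 ?pi_ge0 ?ler0n//.
by apply: IH; rewrite ltnS in bk; exact: ltn_trans bk.
Qed.

Definition diam A : \bar R :=
  ereal_sup [set r | exists x y, [/\ A x, A y & r = (enorm (x - y))%:E]].

(* The empty set has weight 0 also when m = 0, and singletons then have
   weight 1. *)
Definition hausdorff_weight A : \bar R :=
  if `[< A = set0 >] then 0
  else (unit_ball_volume m * (fine (diam A) / 2) ^+ m)%:E.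

Definition delta_cover (delta : R) A : set ((set E)^nat) :=
  [set C | (forall k, diam (C k) <= delta%:E) /\ A `<=` \bigcup_k C k].

Definition hausdorff_delta (delta : R) A : \bar R :=
  ereal_inf [set \sum_(k <oo) hausdorff_weight (C k) | C in delta_cover delta A].

Definition hausdorff A : \bar R :=
  ereal_sup [set hausdorff_delta delta A | delta in [set d : R | (0 < d)%R]].

Lemma diam_ge0 A : A !=set0 -> 0 <= diam A.
Proof.
move=> [x Ax]; apply: ereal_sup_ubound; exists x, x; split=> //.
rewrite subrr /enorm /dot big1 ?sqrtr0// => i _.
by rewrite !mxE mul0r.
Qed.

Lemma hausdorff_weight_ge0 A : 0 <= hausdorff_weight A.
Proof.
rewrite /hausdorff_weight; case: asboolP => // /eqP/set0P A0.
rewrite lee_fin mulr_ge0 ?unit_ball_volume_ge0// exprn_ge0// divr_ge0//.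
exact/fine_ge0/diam_ge0.
Qed.

Lemma hausdorff_delta_ge0 delta A : 0 <= hausdorff_delta delta A.
Proof.
apply: le_ereal_inf_tmp => _ [C _ <-].
by apply: nneseries_ge0 => k _ _; exact: hausdorff_weight_ge0.
Qed.

Lemma hausdorff_delta0 delta : hausdorff_delta delta set0 = 0.
Proof.
apply/eqP; rewrite eq_le hausdorff_delta_ge0 andbT.
apply: ereal_inf_lbound; exists (fun=> set0).
  split=> [k|]; last exact: sub0set.
  rewrite /diam [X in ereal_sup X](_ : _ = set0) ?ereal_sup0 ?leNye//.
  by rewrite -subset0 => r [x [y []]].
rewrite eseries0// => k _ _; rewrite /hausdorff_weight.
by case: asboolP.
Qed.

Lemma le_hausdorff_delta delta :
  {homo hausdorff_delta delta : A B / A `<=` B >-> A <= B}.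
Proof.
move=> A B AB; apply/ereal_inf_le_tmp => _ [C [dC BC] <-].
by exists C => //; split=> //; exact: subset_trans BC.
Qed.

Lemma hausdorff_delta_sigma_subadditive delta :
  sigma_subadditive (hausdorff_delta delta).
Proof.
move=> A; have [[i ioo]|] := pselect (exists i, hausdorff_delta delta (A i) = +oo).
  rewrite (eseries_pinfty _ _ ioo) ?leey// => k _.
  by rewrite -ltNye (lt_le_trans _ (hausdorff_delta_ge0 _ _)).
rewrite -forallNE => Aoo.
suff add2e (e : {posnum R}) : hausdorff_delta delta (\bigcup_k A k) <=
    \sum_(i <oo) hausdorff_delta delta (A i) + e%:num%:E.
  by apply/lee_addgt0Pr => _/posnumP[].
rewrite (le_trans _ (epsilon_trick _ _ _))//; last first.
  by move=> k; exact: hausdorff_delta_ge0.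
pose P k (B : (set E)^nat) := delta_cover delta (A k) B /\
  \sum_(l <oo) hausdorff_weight (B l) <=
    hausdorff_delta delta (A k) + (e%:num / (2 ^ k.+1)%:R)%:E.
have [G PG] : {G : ((set E)^nat)^nat & forall k, P k (G k)}.
  apply: (@choice _ _ P) => k; rewrite /P /hausdorff_delta.
  set S := (X in ereal_inf X); move infS : (ereal_inf S) => iS.
  case: iS infS => [r Sr|Soo|Soo].
  - have en1 : (0 < e%:num / (2 ^ k.+1)%:R)%R by [].
    have /(lb_ereal_inf_adherent en1) : ereal_inf S \is a fin_num by rewrite Sr.
    move=> [x [B AB muBx] xS].
    by exists B; split => //; rewrite muBx -Sr; exact/ltW.
  - by have := Aoo k; rewrite /hausdorff_delta Soo.
  - suff : lbound S 0 by move/le_ereal_inf_tmp; rewrite Soo.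
    move=> /= _ [B _ <-].
    by apply: nneseries_ge0 => l _ _; exact: hausdorff_weight_ge0.
have wG_ge0 x : 0 <= (hausdorff_weight \o uncurry G) x.
  exact: hausdorff_weight_ge0.
apply: (@le_trans _ _ (\esum_(i in setT) (hausdorff_weight \o uncurry G) i)).
  apply: ereal_inf_lbound => /=.
  have /card_esym/ppcard_eqP[f] := card_nat2.
  exists (uncurry G \o f).
    split => [i|]; first by rewrite /= /uncurry; case: (f i) => a b; exact: (PG a).1.1.
    apply: (@subset_trans _ (\bigcup_k \bigcup_l G k l)) => [t [i _]|].
      by case: (PG i) => -[_ sub] _ /sub[j _ ?]; exists i => //; exists j.
    move=> t [i _ [j _ Bijt]]; exists (f^-1%FUN (i, j)) => //=.
    by rewrite invK ?inE.
  rewrite -(esum_pred_image (hausdorff_weight \o uncurry G) _ xpredT) ?[fun=> _]set_true//.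
  by rewrite image_eq.
rewrite (_ : esum _ _ = \sum_(i <oo) \sum_(j <oo) hausdorff_weight (G i j)); last first.
  pose J : nat -> set (nat * nat) := fun i => [set (i, j) | j in setT].
  rewrite (_ : setT = \bigcup_k J k); last first.
    by rewrite predeqE => -[a b]; split => // _; exists a => //; exists b.
  rewrite esum_bigcupT //=; last first.
    apply/trivIsetP => i j _ _ ij.
    rewrite predeqE => -[k l] /=; split => //= -[] [_] _ [<-{k} _].
    by move=> [l' _] [] /esym/eqP; rewrite (negbTE ij).
  rewrite -(image_id [set: nat]) -fun_true esum_pred_image//; last first.
    by move=> k _; apply: esum_ge0 => x _; exact: wG_ge0.
  apply: eq_eseriesr => /= j _.
  rewrite -(esum_pred_image (hausdorff_weight \o uncurry G) (pair j) predT)/=; last 2 first.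
  - by move=> l _; exact: hausdorff_weight_ge0.
  - by move=> ? ? _ _; exact: (@can_inj _ _ _ snd).
  by congr esum; rewrite predeqE => -[a b]; split; move=> [i _ <-]; exists i.
apply: lee_nneseries => [i _ _|i _].
  by apply: nneseries_ge0 => j _ _; exact: hausdorff_weight_ge0.
exact: (PG i).2.
Qed.

Lemma hausdorff0 : hausdorff set0 = 0.
Proof.
apply/eqP; rewrite eq_le; apply/andP; split.
  by apply: ge_ereal_sup => _ [d _ <-]; rewrite hausdorff_delta0.
by apply: ereal_sup_ubound; exists 1%R; rewrite /= ?ltr01// hausdorff_delta0.
Qed.

Lemma hausdorff_ge0 A : 0 <= hausdorff A.
Proof.
apply: le_trans (hausdorff_delta_ge0 1 A) _.
by apply: ereal_sup_ubound; exists 1%R; rewrite //= ltr01.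
Qed.

Lemma le_hausdorff : {homo hausdorff : A B / A `<=` B >-> A <= B}.
Proof.
move=> A B AB; apply: ge_ereal_sup => _ [d d0 <-].
apply: le_trans (le_hausdorff_delta d AB) _.
by apply: ereal_sup_ubound; exists d.
Qed.

Lemma hausdorff_sigma_subadditive : sigma_subadditive hausdorff.
Proof.
move=> A; apply: ge_ereal_sup => _ [d d0 <-].
apply: le_trans (hausdorff_delta_sigma_subadditive d A) _.
apply: lee_nneseries => [i _ _|i _]; first exact: hausdorff_delta_ge0.
by apply: ereal_sup_ubound; exists d.
Qed.

HB.instance Definition _ := isOuterMeasure.Build R E hausdorff
  hausdorff0 hausdorff_ge0 le_hausdorff hausdorff_sigma_subadditive.

Definition hausdorff_outer : {outer_measure set E -> \bar R} := hausdorff.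

(* H^m as a measure on its Caratheodory sigma-algebra. *)
Definition hausdorff_measure :
  {measure set (caratheodory_type hausdorff_outer) -> \bar R} := hausdorff_outer.

End hausdorff.

Section varifolds.
Context (R : realType) (n : nat).
Local Notation E := 'rV[R]_n.+1.
Local Notation X := ('rV[R]_n.+1 * 'M[R]_n.+1)%type.
Implicit Types (m : nat) (U S M : set E) (P : 'M[R]_n.+1).

(* Orthogonal projections of rank m; row vectors are projected by v *m P, and
   the order is immaterial since P is symmetric. *)
Definition grassmannian m : set 'M[R]_n.+1 :=
  [set P | [/\ P^T = P, P *m P = P & \rank P = m]].

Definition subspace_of P : set E := [set v | v *m P = v].

Definition Gr m U : set X := U `*` grassmannian m.

(* A Radon measure on a subset D of X is encoded as a Borel measure on X which
   vanishes outside D and is finite on the compact subsets of D. *)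
Definition radon_on (D : set X) (mu : set X -> \bar R) : Prop :=
  (forall K, compact K -> K `<=` D -> (mu K < +oo)%E) /\ mu (~` D) = 0%E.

Definition varifold m U (V : set X -> \bar R) : Prop := radon_on (Gr m U) V.

Definition hausdorff_measurable m M : Prop :=
  measurable (M : set (caratheodory_type (@hausdorff_outer R n m))).

Definition rectifiable m M : Prop :=
  hausdorff_measurable m M /\
  exists (N0 : set E) (F : nat -> 'rV[R]_m -> E),
    [/\ hausdorff m N0 = 0%E,
        forall j, exists L : R,
          forall u v, enorm (F j u - F j v) <= L * enorm (u - v) &
        M `<=` N0 `|` \bigcup_j range (F j)].

Definition approx_tangent m M (x : E) P : Prop :=
  grassmannian m P /\
  forall f : E -> R, continuous f -> compact (closure [set y | f y != 0]) ->
    (\int[@hausdorff_measure R n m]_(y in [set l^-1 *: (z - x) | z in M])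
        (f y)%:E)%E @[l --> 0^'+]
    --> (\int[@hausdorff_measure R n m]_(y in subspace_of P) (f y)%:E)%E.

Definition integral_varifold m U (V : set X -> \bar R) : Prop :=
  varifold m U V /\
  exists (M : set E) (theta : E -> nat),
    [/\ M `<=` U, rectifiable m M,
        forall x, M x -> (0 < theta x)%N,
        forall K, compact K -> K `<=` U ->
          (@hausdorff_measure R n m).-integrable (M `&` K)
            (fun x => ((theta x)%:R)%:E) &
        forall A, measurable (A : set (borel X)) ->
          V A = (\int[@hausdorff_measure R n m]_(x in
                   [set x | M x /\ exists P, approx_tangent m M x P /\ A (x, P)])
                 ((theta x)%:R)%:E)%E].

Implicit Types (phi : X -> E) (B : X -> {bilinear E -> E -> E}).

Local Notation e i := (@basis_vec R n.+1 i).

Definition B_coef B (p : X) (i j k : 'I_n.+1) : R := dot (B p (e i) (e j)) (e k).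

(* D_P phi . B + <tr B, phi> + <nabla_x phi, P>; the coordinate P^k_j is the
   entry P j k. *)
Definition curvature_integrand B phi (p : X) : R :=
  \sum_i \sum_j \sum_k ('D_((0, delta_mx j k) : X) phi p) 0 i * B_coef B p i j k
  + dot (\sum_i B p (e i) (e i)) (phi p)
  + \sum_i \sum_j p.2 i j * ('D_((e i, 0) : X) phi p) 0 j.

(* Elements of L^1(V) are determined up to V-negligible sets; Borel measurability
   is only required of a representative. *)
Definition in_L1 (V : {measure set (borel X) -> \bar R}) (D : set X) B : Prop :=
  forall i j k, exists g : X -> R,
    V.-integrable D (fun p => (g p)%:E) /\
    {ae V, forall p, D p -> B_coef B p i j k = g p}.

Definition relatively_compact_in (D A : set X) : Prop :=
  exists K, [/\ compact K, K `<=` D & A `<=` K].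

(* A vector Radon measure on D is countably additive on the Borel subsets of
   each compact subset of D; its values on other sets are irrelevant. *)
Definition vector_radon_on (D : set X) (mu : set X -> E) : Prop :=
  forall K, compact K -> K `<=` D ->
  forall F : nat -> set X,
    (forall i, measurable (F i : set (borel X)) /\ F i `<=` K) ->
    trivIset setT F ->
    (fun N => \sum_(i < N) mu (F i)) @ \oo --> mu (\bigcup_i F i).

Definition vector_total_variation (D : set X) (mu : set X -> E) (A : set X) : \bar R :=
  ereal_sup [set (\sum_(i <oo) (enorm (mu (F i)))%:E)%E | F in
    [set F : nat -> set X |
      [/\ forall i, measurable (F i : set (borel X)),
          forall i, relatively_compact_in D (F i),
          trivIset setT F & \bigcup_i F i = A]]].

(* Positive part in the Jordan decomposition of the real Radon measure nu
   on D. *)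
Definition positive_part (D : set X) (nu : set X -> R) (A : set X) : \bar R :=
  ereal_sup [set (nu C)%:E | C in
    [set C | [/\ measurable (C : set (borel X)), C `<=` A &
                 relatively_compact_in D C]]].

Definition signed_integral (D : set X) (nu : set X -> R) (f : X -> R) : \bar R :=
  (integral (positive_part D nu : set (borel X) -> \bar R) D (fun p => (f p)%:E)
   - integral (positive_part D (fun A => - nu A)%R : set (borel X) -> \bar R) D
       (fun p => (f p)%:E))%E.

Definition vector_integral (D : set X) (mu : set X -> E) phi : \bar R :=
  (\sum_j signed_integral D (fun A => (mu A 0 j)%R) (fun p => (phi p 0 j)%R))%E.

(* Mantegazza's notion; bV is the boundary measure. *)
Definition curvature_varifold_with_boundary m U
    (V : {measure set (borel X) -> \bar R}) B (bV : set X -> E) : Prop :=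
  [/\ open U, integral_varifold m U V,
      forall K, compact K -> K `<=` Gr m U -> in_L1 V K B,
      vector_radon_on (Gr m U) bV &
      forall phi, C1_on setT phi ->
        compact (closure [set p | phi p != 0]) ->
        closure [set p | phi p != 0] `<=` U `*` setT ->
        (\int[V]_(p in Gr m U) (curvature_integrand B phi p)%:E)%E
        = (- vector_integral (Gr m U) bV phi)%E].

Definition capillary_bundle m (Omega : set E) (beta : E -> R) : set X :=
  [set p | [/\ frontier Omega p.1, grassmannian m p.2,
      enorm (inner_normal Omega p.1 *m p.2) = sin (beta p.1) &
      forall w, subspace_of p.2 w -> tangent_space Omega p.1 w ->
        dot w (inner_normal Omega p.1 *m p.2) = 0]].

Definition conormal (Omega : set E) (p : X) : E :=
  let v := inner_normal Omega p.1 *m p.2 in (enorm v)^-1 *: v.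

Definition conormal_measure m (Omega : set E) (beta : E -> R)
    (Gamma : {measure set (borel X) -> \bar R}) (A : set X) : E :=
  \row_j \int[Gamma]_(p in A `&` capillary_bundle m Omega beta)
           (conormal Omega p 0 j).

(* V belongs to CV^m_beta(Omega). *)
Definition capillary_curvature_varifold m (Omega : set E) (beta : E -> R)
    (V : {measure set (borel X) -> \bar R}) B
    (Gamma : {measure set (borel X) -> \bar R}) : Prop :=
  [/\ varifold m (closure Omega) V,
      in_L1 V (Gr m (closure Omega)) B,
      radon_on (capillary_bundle m Omega beta) Gamma &
      forall phi, C1_on setT phi ->
        (\int[V]_(p in Gr m (closure Omega)) (curvature_integrand B phi p)%:E)%E
        = (- \int[Gamma]_(p in capillary_bundle m Omega beta)
               (dot (conormal Omega p) (phi p))%:E)%E].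

End varifolds.

(* Main.v *)
Require Import Defs.
From HB Require Import structures.
From mathcomp Require Import all_boot all_order all_algebra.
From mathcomp Require Import sesquilinear.
From mathcomp Require Import all_classical all_reals all_analysis.
From mathcomp Require Import measurable_realfun ring lra.
Set Implicit Arguments.
Unset Strict Implicit.
Unset Printing Implicit Defensive.
Import Order.TTheory GRing.Theory Num.Theory.
Import numFieldNormedType.Exports.
Local Open Scope classical_set_scope.
Local Open Scope ring_scope.

(* Two local defining functions of Omega have the same normalised gradient on
   the frontier S, so the inner normal nu is continuous on S.  Hence the
   capillary bundle is compact and, since |P nu| = sin beta > 0 on it, the
   conormal n is a continuous field of unit vectors there; in particular Gamma
   is a finite measure and n Gamma a finite vector measure.  The Jordan parts
   of its coordinates have the densities n_j^+ and n_j^- with respect to Gamma,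
   so integration against n Gamma is integration of <n, .> against Gamma.
   For the total variation, |n| = 1 gives |n Gamma| <= Gamma; conversely, on a
   set F where the coordinates of n oscillate by at most delta,
   |(n Gamma)(F)| >= (1 - (n+1) delta^2) Gamma(F), and the bounded pieces of a
   grid of mesh delta in the values of n form an admissible partition. *)

(* The integrand built from B is measurable only up to a null set, and
   [positive_part] is not packaged as a measure: the lemmas of this section
   argue on the definition of the integral as a supremum over simple functions. *)
Section integral_without_measurability.
Context {d} {T : measurableType d} {R : realType}.
Variable mu : {measure set T -> \bar R}.
Import HBNNSimple.
Local Open Scope ereal_scope.

(** Multiplying a simple function below [f] by the indicator of the complement of [N] keeps its
    integral, since [N] is null, and puts it below [g] everywhere: off [N] through [f <= g], on [N]
    because [g] is nonnegative. *)
Lemma le_ereal_sup_sintegral_off_null (N : set T) (f g : T -> \bar R) :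
  measurable N -> mu N = 0 -> (forall x, 0 <= g x) ->
  (forall x, ~ N x -> f x <= g x) ->
  ereal_sup [set sintegral mu h | h in
    [set h : {nnsfun T >-> R} | forall x, (h x)%:E <= f x]] <=
  ereal_sup [set sintegral mu h | h in
    [set h : {nnsfun T >-> R} | forall x, (h x)%:E <= g x]].
Proof.
move=> mN N0 g0 fg; apply: ge_ereal_sup => _ [h /= hf <-].
apply: ereal_sup_ubound; exists (proj_nnsfun h (measurableC mN)) => [x /=|].
  rewrite mindicE; have [/set_mem Nx|_] := boolP (x \in ~` N).
    by rewrite mulr1; apply: le_trans (hf x) _; exact: fg.
  by rewrite mulr0.
rewrite -!integralT_nnsfun; apply: ae_eq_integral => //.
- exact/measurable_EFinP.
- exact/measurable_EFinP.
- exists N; split => // x /= /not_implyP[_]; apply: contra_notP => Nx.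
  by rewrite mindicE mem_set// mulr1.
Qed.

(** Serves to move the integral of the curvature integrand between domains that differ by a null
    set; positive and negative parts are each compared in both directions. *)
Lemma integral_eq_off_null (N D D' : set T) (f g : T -> \bar R) :
  measurable N -> mu N = 0 -> (forall x, ~ N x -> (f \_ D) x = (g \_ D') x) ->
  \int[mu]_(x in D) f x = \int[mu]_(x in D') g x.
Proof.
move=> mN N0 fg; rewrite /integral.
have eq_sup (u v : T -> \bar R) : (forall x, 0 <= u x) -> (forall x, 0 <= v x) ->
    (forall x, ~ N x -> u x = v x) ->
    ereal_sup [set sintegral mu h | h in
      [set h : {nnsfun T >-> R} | forall x, (h x)%:E <= u x]] =
    ereal_sup [set sintegral mu h | h in
      [set h : {nnsfun T >-> R} | forall x, (h x)%:E <= v x]].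
  move=> u0 v0 uv; apply/eqP; rewrite eq_le; apply/andP; split;
    by apply: (le_ereal_sup_sintegral_off_null mN N0) => // x Nx; rewrite uv.
by congr (_ - _); apply: eq_sup => // x Nx; rewrite ?funeposE ?funenegE fg.
Qed.

(** The integral sees a set function only through its values on level sets of simple functions,
    which are measurable. This lets a genuine measure replace [positive_part]. *)
Lemma integral_eq_set_function (m : set T -> \bar R) (D : set T) (f : T -> \bar R) :
  (forall A, measurable A -> m A = mu A) -> integral m D f = \int[mu]_(x in D) f x.
Proof.
move=> mmu; rewrite /integral.
have sE (h : {nnsfun T >-> R}) : sintegral m h = sintegral mu h.
  by apply: eq_fsbigr => r _; rewrite mmu.
by congr (ereal_sup _ - ereal_sup _); apply/eq_imagel => h _; rewrite sE.
Qed.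

End integral_without_measurability.

(** * Measures with a nonnegative density *)

Section density.
Context {d} {T : measurableType d} {R : realType}.
Variables (mu : {measure set T -> \bar R}) (g : T -> R).
Hypotheses (mg : measurable_fun setT g) (g0 : forall x, (0 <= g x)%R).
Local Open Scope ereal_scope.

(** The two proofs are arguments so that the measure structure declared below can be found from the
    term itself. *)
Definition density of measurable_fun setT g & (forall x, (0 <= g x)%R) :=
  fun A : set T => \int[mu]_(x in A) (g x)%:E.

Let nu := density mg g0.

Let nu0 : nu set0 = 0. Proof. exact: integral_set0. Qed.

Let nu_ge0 A : 0 <= nu A. Proof. by apply: integral_ge0 => x _; rewrite lee_fin. Qed.

Let nu_sigma_additive : semi_sigma_additive nu.
Proof.
apply: semi_sigma_additive_nng_induced => [|x]; last by rewrite lee_fin.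
exact/measurable_EFinP.
Qed.

HB.instance Definition _ := isMeasure.Build _ _ _ nu nu0 nu_ge0 nu_sigma_additive.

Import HBNNSimple.

Let integral_density_nnsfun (h : {nnsfun T >-> R}) :
  \int[nu]_x (h x)%:E = \int[mu]_x ((h x)%:E * (g x)%:E).
Proof.
rewrite integralT_nnsfun sintegralE.
under [RHS]eq_integral => x _.
  rewrite fimfunE -fsumEFin// ge0_mule_fsuml; last first.
    by move=> r; rewrite EFinM nnfun_muleindic_ge0.
  over.
rewrite ge0_integral_fsum//; last 2 first.
- move=> r; apply: emeasurable_funM => //.
  by apply/measurable_EFinP; do 2 apply/measurableT_comp => //.
  exact/measurable_EFinP.
- by move=> r x _; rewrite mule_ge0 ?lee_fin// -lee_fin nnfun_muleindic_ge0.
(* On each level set of [h], both sides are the value of [h] times the integral of [g] over that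
   set. *)
apply: eq_fsbigr => r /set_mem[x _ <-]; rewrite /nu/= /density.
have mgh : measurable_fun (h @^-1` [set h x]) (fun y => (g y)%:E).
  by apply/measurable_EFinP/measurable_funTS.
rewrite -(ge0_integralZl mu _ mgh) ?lee_fin//; last by move=> y _; rewrite lee_fin.
rewrite [LHS]integral_mkcond; apply: eq_integral => y _.
by rewrite indicE /patch; case: ifP => _; rewrite ?mulr1// mulr0 mul0e.
Qed.

(** Both sides are monotone limits of the case of simple functions; [g >= 0] keeps the products
    increasing. *)
Lemma ge0_integral_density f : measurable_fun setT f -> (forall x, 0 <= f x) ->
  \int[nu]_x f x = \int[mu]_x (f x * (g x)%:E).
Proof.
move=> mf f0; pose f_ := nnsfun_approx measurableT mf.
transitivity (limn (fun n => \int[nu]_x (f_ n x)%:E)).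
  rewrite -monotone_convergence//=.
  - apply: eq_integral => x _; apply/esym/cvg_lim => //=.
    exact: cvg_nnsfun_approx.
  - by move=> n; apply: measurableT_comp.
  - by move=> n x _; rewrite lee_fin.
  - by move=> x _ a b ab; rewrite lee_fin//; exact/lefP/nd_nnsfun_approx.
under eq_fun do rewrite integral_density_nnsfun.
rewrite -monotone_convergence//=.
- apply: eq_integral => x _; apply/cvg_lim => //=.
  by apply: cvgeMr => //; exact: cvg_nnsfun_approx.
- by move=> n; apply/measurable_EFinP/measurable_funM.
- by move=> n x _; rewrite mule_ge0// lee_fin.
- move=> x _ a b ab; rewrite lee_wpmul2r ?lee_fin//.
  exact/lefP/nd_nnsfun_approx.
Qed.

(** Multiplication by the nonnegative [g] commutes with taking positive and negative parts, which
    reduces the claim to the nonnegative case. *)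
Lemma integral_density (D : set T) (f : T -> R) :
  measurable D -> measurable_fun setT f ->
  \int[nu]_(x in D) (f x)%:E = \int[mu]_(x in D) (f x * g x)%:E.
Proof.
move=> mD mf; pose F : T -> \bar R := (EFin \o f) \_ D.
have mF : measurable_fun setT F.
  by apply/(measurable_restrictT _ mD).1; apply: measurable_funTS; apply/measurable_EFinP.
transitivity (\int[nu]_x F x); first exact: integral_mkcond.
transitivity (\int[mu]_x (F x * (g x)%:E)); last first.
  rewrite [RHS]integral_mkcond; apply: eq_integral => x _.
  by rewrite /F !patchE; case: ifP => _; rewrite ?EFinM ?mul0e.
rewrite [LHS]integralE [RHS]integralE.
rewrite !ge0_integral_density//; last 2 first.
- exact: measurable_funeneg.
- exact: measurable_funepos.
congr (_ - _); apply: eq_integral => x _.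
  by rewrite !funeposE maxe_pMl ?lee_fin// mul0e.
by rewrite !funenegE -mulNe maxe_pMl ?lee_fin// mul0e.
Qed.

End density.

(** * Euclidean inner product and norm *)

Section euclidean.
Context {R : realType} {n : nat}.
Implicit Types u v w : 'rV[R]_n.

Lemma dotC u v : dot u v = dot v u.
Proof. by apply: eq_bigr => i _; rewrite mulrC. Qed.

Lemma dotDl u v w : dot (u + v) w = dot u w + dot v w.
Proof. by rewrite /dot -big_split; apply: eq_bigr => i _; rewrite mxE mulrDl. Qed.

Lemma dotZl a u v : dot (a *: u) v = a * dot u v.
Proof. by rewrite /dot mulr_sumr; apply: eq_bigr => i _; rewrite mxE mulrA. Qed.

Lemma dotDr u v w : dot w (u + v) = dot w u + dot w v.
Proof. by rewrite dotC dotDl !(dotC w). Qed.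

Lemma dotZr a u v : dot u (a *: v) = a * dot u v.
Proof. by rewrite dotC dotZl dotC. Qed.

Lemma dotNl u v : dot (- u) v = - dot u v.
Proof. by rewrite -scaleN1r dotZl mulN1r. Qed.

Lemma dotNr u v : dot u (- v) = - dot u v.
Proof. by rewrite dotC dotNl dotC. Qed.

Lemma dot_mul_sym u v (P : 'M[R]_n) : P^T = P -> dot (u *m P) v = dot u (v *m P).
Proof.
move=> PT; have dotE (a b : 'rV[R]_n) : dot a b = (a *m b^T) 0 0.
  by rewrite mxE; apply: eq_bigr => i _; rewrite mxE.
by rewrite !dotE trmx_mul PT mulmxA.
Qed.

Lemma dot_ge0 u : 0 <= dot u u.
Proof. by apply: sumr_ge0 => i _; rewrite -expr2 sqr_ge0. Qed.

Lemma dot_eq0 u : (dot u u == 0) = (u == 0).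
Proof.
apply/eqP/eqP => [u0|->]; last by rewrite /dot big1// => i _; rewrite mxE mul0r.
apply/rowP => i; rewrite mxE; apply/eqP; rewrite -sqrf_eq0 expr2; apply/eqP.
by apply: (psumr_eq0P _ u0) => // j _; rewrite -expr2 sqr_ge0.
Qed.

Lemma enorm_ge0 u : 0 <= enorm u. Proof. exact: sqrtr_ge0. Qed.

Lemma sqr_enorm u : enorm u ^+ 2 = dot u u.
Proof. by rewrite sqr_sqrtr// dot_ge0. Qed.

Lemma enorm_eq0 u : (enorm u == 0) = (u == 0).
Proof. by rewrite -sqrf_eq0 sqr_enorm dot_eq0. Qed.

Lemma enorm_gt0 u : (0 < enorm u) = (u != 0).
Proof. by rewrite lt_neqAle enorm_ge0 andbT eq_sym enorm_eq0. Qed.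

Lemma enorm_normalize u : u != 0 -> enorm ((enorm u)^-1 *: u) = 1.
Proof.
move=> u0; rewrite {1}/enorm dotZl dotZr mulrA -sqr_enorm -expr2 -exprMn.
by rewrite mulVf ?enorm_eq0// expr1n sqrtr1.
Qed.

(** Cauchy-Schwarz in normalised form, from expanding the squared distance between [u / |u|] and
    [v]. *)
Lemma dot_le_unit u v : enorm v = 1 -> dot u v <= enorm u.
Proof.
move=> v1; have [->|u0] := eqVneq u 0.
  by rewrite -(scale0r v) dotZl mul0r enorm_ge0.
have := dot_ge0 ((enorm u)^-1 *: u - v).
rewrite dotDl !dotDr !dotNl !dotNr !dotZl !dotZr.
rewrite -sqr_enorm (dotC v u) -(sqr_enorm v) v1.
have u_gt0 : 0 < enorm u by rewrite enorm_gt0.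
have -> : (enorm u)^-1 * ((enorm u)^-1 * enorm u ^+ 2) = 1.
  by field; rewrite gt_eqF.
move=> h; suff : (enorm u)^-1 * dot u v <= 1 by rewrite ler_pdivrMl// mulr1.
lra.
Qed.

Lemma dot_basis u : \sum_i u 0 i *: @basis_vec R n i = u.
Proof. by rewrite [RHS]row_sum_delta. Qed.

End euclidean.

(** * Limits of matrix-valued functions *)

Section matrix_limits.
Context {R : realType} {T : Type} {F : set_system T} {FF : Filter F}.

Lemma cvg_coord p q (f : T -> 'M[R]_(p, q)) (M : 'M[R]_(p, q)) i j :
  f x @[x --> F] --> M -> f x i j @[x --> F] --> M i j.
Proof.
move=> fM; apply: (cvg_comp _ (fun N : 'M[R]_(p, q) => N i j) fM).
exact: (@coord_continuous _ _ _ i j M).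
Qed.

(** A neighbourhood of a matrix contains a product of neighbourhoods of its finitely many
    entries. *)
Lemma cvg_mx_coord p q (f : T -> 'M[R]_(p, q)) (M : 'M[R]_(p, q)) :
  (forall i j, f x i j @[x --> F] --> M i j) -> f x @[x --> F] --> M.
Proof.
move=> fM A [P MP PA]; rewrite /nbhs/=.
suff : \forall x \near F, forall i j, P i j (f x i j).
  by apply: filterS => x; exact: PA.
apply: filter_forall => i; apply: filter_forall => j; exact: fM.
Qed.

Lemma cvg_sum_fin (I : Type) (r : seq I) (f : I -> T -> R) (l : I -> R) :
  (forall i, f i x @[x --> F] --> l i) ->
  (\sum_(i <- r) f i x) @[x --> F] --> \sum_(i <- r) l i.
Proof.
move=> fl; elim: r => [|i r IH].
  by rewrite big_nil; under eq_fun do rewrite big_nil; exact: cvg_cst.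
by rewrite big_cons; under eq_fun do rewrite big_cons; exact: cvgD.
Qed.

Lemma cvg_mulmx p q r (f : T -> 'M[R]_(p, q)) (g : T -> 'M[R]_(q, r))
    (A : 'M[R]_(p, q)) (B : 'M[R]_(q, r)) :
  f x @[x --> F] --> A -> g x @[x --> F] --> B ->
  (f x *m g x) @[x --> F] --> A *m B.
Proof.
move=> fA gB; apply: cvg_mx_coord => i j; rewrite mxE.
under eq_fun do rewrite mxE.
by apply: cvg_sum_fin => k; apply: cvgM; exact: cvg_coord.
Qed.

Lemma cvg_dot p (f g : T -> 'rV[R]_p) (u v : 'rV[R]_p) :
  f x @[x --> F] --> u -> g x @[x --> F] --> v ->
  dot (f x) (g x) @[x --> F] --> dot u v.
Proof.
by move=> fu gv; apply: cvg_sum_fin => k; apply: cvgM; exact: cvg_coord.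
Qed.

Lemma cvg_enorm p (f : T -> 'rV[R]_p) (u : 'rV[R]_p) :
  f x @[x --> F] --> u -> enorm (f x) @[x --> F] --> enorm u.
Proof.
move=> fu; apply: (@cvg_comp _ _ _ (fun x => dot (f x) (f x)) Num.sqrt).
  exact: (cvg_dot fu fu).
exact: sqrt_continuous.
Qed.

Lemma cvg_normalize p (f : T -> 'rV[R]_p) (u : 'rV[R]_p) : u != 0 ->
  f x @[x --> F] --> u ->
  ((enorm (f x))^-1 *: f x) @[x --> F] --> (enorm u)^-1 *: u.
Proof.
move=> u0 fu; apply: cvgZ => //; apply: cvgV; rewrite ?enorm_eq0//.
exact: cvg_enorm.
Qed.

End matrix_limits.

(** * Compactness of the Grassmannian *)

Lemma idempotent_mxtrace (F : fieldType) n (P : 'M[F]_n) :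
  P *m P = P -> \tr P = (\rank P)%:R.
Proof.
move=> PP.
move: (col_base P) (row_base P) (row_base_free P) (col_base_full P) (mulmx_base P).
move: (\rank P) => k C D freeD fullC CD.
(* In the full-rank factorisation [P = C D], idempotence reads [C D C D = C D]; cancelling [C] on
   the left and [D] on the right leaves [D C = 1], whose trace is the rank. *)
have DC : D *m C = 1%:M.
  apply: (row_free_inj freeD); rewrite mul1mx; apply: (row_full_inj fullC).
  by rewrite !mulmxA CD -mulmxA CD PP.
by rewrite -CD mxtrace_mulC DC mxtrace1.
Qed.

Section grassmannian.
Context {R : realType} {n : nat}.

(** The rank is not continuous, but on idempotents it equals the trace, so the Grassmannian is cut
    out by equations between continuous functions. *)
Lemma closed_grassmannian m : closed (@grassmannian R n m).
Proof.
have -> : @grassmannian R n m =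
    \bigcap_(ij in [set: 'I_n.+1 * 'I_n.+1])
      ((fun P : 'M[R]_n.+1 => P ij.2 ij.1 - P ij.1 ij.2) @^-1` [set x | x = 0]) `&`
    \bigcap_(ij in [set: 'I_n.+1 * 'I_n.+1])
      ((fun P : 'M[R]_n.+1 => (P *m P) ij.1 ij.2 - P ij.1 ij.2) @^-1` [set x | x = 0]) `&`
    ((fun P : 'M[R]_n.+1 => \tr P) @^-1` [set x | x = m%:R]).
  apply/seteqP; split => P /=.
    move=> [PT PP rP]; split; last by rewrite idempotent_mxtrace// rP.
    by split => -[i j] _ /=; rewrite ?PP ?subrr// -[in X in X - _]PT mxE subrr.
  move=> [[PT PP] trP].
  have PPE : P *m P = P by apply/matrixP => i j; apply/subr0_eq/(PP (i, j) I).
  split => //; first by apply/matrixP => i j; rewrite mxE; apply/subr0_eq/(PT (i, j) I).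
  by apply/eqP; rewrite -(eqr_nat R) -idempotent_mxtrace// trP.
have coordc i j : continuous (fun P : 'M[R]_n.+1 => P i j) by exact: coord_continuous.
apply: closedI; [apply: closedI|]; [apply: closed_bigI => ij _..|];
  apply: preimage_closed => [P _|]; try exact: closed_eq.
- exact: (cvgB (coordc _ _ P) (coordc _ _ P)).
- apply: (cvgB _ (coordc _ _ P)); apply: (@cvg_coord _ _ (nbhs P)).
  exact: (cvg_mulmx (@cvg_id _ (nbhs P)) (@cvg_id _ (nbhs P))).
- by apply: (@cvg_sum_fin _ _ (nbhs P)) => i; exact: coordc.
Qed.

(** The continuous map [vec_mx] carries a compact cube of row vectors onto this set. *)
Lemma compact_mx_cube (M : R) :
  compact [set P : 'M[R]_n.+1 | forall i j, `|P i j| <= M].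
Proof.
have cu : compact [set v : 'rV[R]_(n.+1 * n.+1) | forall i, v ord0 i \in `[- M, M]].
  by apply: (@rV_compact _ _ (fun=> `[- M, M]%classic)) => _; exact: segment_compact.
rewrite (_ : mkset _ = vec_mx @`
    [set v : 'rV[R]_(n.+1 * n.+1) | forall i, v ord0 i \in `[- M, M]]).
  apply: continuous_compact cu; apply: continuous_subspaceT => v.
  apply: (@cvg_mx_coord _ _ (nbhs v)) => i j; rewrite !mxE.
  by under eq_fun do rewrite mxE; exact: coord_continuous.
apply/seteqP; split => [P PM|_ [v vM <-] i j]; last first.
  by rewrite mxE ler_norml; exact: vM.
exists (mxvec P); last exact: mxvecK.
by move=> k; case/mxvec_indexP: k => i j; rewrite mxvecE in_itv/= -ler_norml.
Qed.

(** Symmetry and idempotence make [P k k] the sum of the squares of row [k]. Hence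
    [P k k ^+ 2 <= P k k], so [P k k <= 1], and every entry is at most 1 in absolute value. *)
Lemma compact_grassmannian m : compact (@grassmannian R n m).
Proof.
apply: (subclosed_compact (@closed_grassmannian m) (@compact_mx_cube 1)).
move=> P [PT PP _] i j.
have Pii k : P k k = \sum_l P k l ^+ 2.
  rewrite -[in LHS]PP mxE; apply: eq_bigr => l _.
  by rewrite -[in X in _ * X]PT mxE expr2.
have le_Pii k l : P k l ^+ 2 <= P k k.
  rewrite [leRHS]Pii (bigD1 l)//= lerDl; apply: sumr_ge0 => ? _; exact: sqr_ge0.
have Pii_ge0 : 0 <= P i i by apply: le_trans (le_Pii i i); exact: sqr_ge0.
have Pii_le1 : P i i <= 1 by have := le_Pii i i; nra.
rewrite -(@expr_le1 _ 2)// real_normK ?num_real//.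
exact: le_trans (le_Pii i j) _.
Qed.

Lemma compact_Gr m (K : set 'rV[R]_n.+1) : compact K -> compact (Gr m K).
Proof. by move=> cK; apply: compact_setX => //; exact: compact_grassmannian. Qed.

End grassmannian.

(** * Uniqueness and continuity of the inner normal *)

Section inner_normal.
Context {R : realType} {n : nat}.
Local Notation E := 'rV[R]_n.+1.
Implicit Types (Omega U : set E) (x v : E) (rho : E -> R).

Lemma dot_grad rho x v : differentiable rho x -> dot (grad rho x) v = 'D_v rho x.
Proof.
move=> drho; rewrite deriveE// -[in RHS](dot_basis v) linear_sum.
by apply: eq_bigr => i _; rewrite linearZ/= mxE deriveE// mulrC.
Qed.

Lemma frontier_open_notin Omega x : open Omega -> frontier Omega x -> ~ Omega x.
Proof. by move=> /interior_id oO [_]; rewrite oO. Qed.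

Lemma C2_defining_move Omega x y U rho :
  C2_defining Omega x U rho -> U y -> C2_defining Omega y U rho.
Proof. by case. Qed.

(** A positive value would put [x] in [Omega], which is open and misses its frontier; a negative one
    would persist near [x] and keep [x] out of the closure. *)
Lemma C2_defining_frontier Omega x U rho :
  open Omega -> frontier Omega x -> C2_defining Omega x U rho -> rho x = 0.
Proof.
move=> oO fx [oU Ux [[drho _] _] rhoE _].
have rho_le0 : rho x <= 0.
  by rewrite leNgt; apply/negP => /(rhoE x Ux); exact: frontier_open_notin.
apply/eqP; rewrite eq_le rho_le0 leNgt; apply/negP => rhox.
have rho_lt0 : \forall y \near x, rho y < 0.
  exact: (cvgr_lt (rho x) (differentiable_continuous (drho x Ux))).
have : nbhs x [set y | U y /\ rho y < 0].
  by apply: filterI => //; exact: open_nbhs_nbhs.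
move=> /fx.1[y [Oy [Uy rhoy]]].
by move/(rhoE y Uy): Oy; rewrite ltNge ltW.
Qed.

(** As [rho x = 0], the difference quotient is [rho (t *: v + x) / t], and it has the sign of its
    limit for small [t]. *)
Lemma derive_gt0_near rho x v : differentiable rho x -> rho x = 0 ->
  0 < 'D_v rho x -> \forall t \near 0^'+, 0 < rho (t *: v + x).
Proof.
move=> drho rhox0 Dpos.
have /(cvgr_gt _) /(_ _ Dpos) := @diff_derivable _ _ _ rho x v drho.
apply: (@filterS _ (nbhs (0:R))) => t tP t0; have := tP (lt0r_neq0 t0).
by rewrite /= rhox0 subr0 /GRing.scale/= pmulr_rgt0// invr_gt0.
Qed.

Lemma derive_lt0_near rho x v : differentiable rho x -> rho x = 0 ->
  'D_v rho x < 0 -> \forall t \near 0^'+, rho (t *: v + x) < 0.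
Proof.
move=> drho rhox0 Dneg.
have /(cvgr_lt _) /(_ _ Dneg) := @diff_derivable _ _ _ rho x v drho.
apply: (@filterS _ (nbhs (0:R))) => t tP t0; have := tP (lt0r_neq0 t0).
by rewrite /= rhox0 subr0 /GRing.scale/= pmulr_rlt0// invr_gt0.
Qed.

(* If two defining functions had different normalised gradients, moving along
   the difference would increase one of them and decrease the other. *)
Lemma normalized_grad_unique Omega x U1 rho1 U2 rho2 :
  open Omega -> frontier Omega x ->
  C2_defining Omega x U1 rho1 -> C2_defining Omega x U2 rho2 ->
  (enorm (grad rho1 x))^-1 *: grad rho1 x = (enorm (grad rho2 x))^-1 *: grad rho2 x.
Proof.
move=> oO fx def1 def2.
have r1 := C2_defining_frontier oO fx def1.
have r2 := C2_defining_frontier oO fx def2.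
case: def1 => oU1 U1x [[d1 _] _] E1 g1; case: def2 => oU2 U2x [[d2 _] _] E2 g2.
have /eqP g1x := g1 x U1x; have /eqP g2x := g2 x U2x.
set n1 := _ *: grad rho1 x; set n2 := _ *: grad rho2 x.
apply/eqP; apply: contrapT => /negP n12.
have dn1 : dot n1 n1 = 1 by rewrite -sqr_enorm enorm_normalize// expr1n.
have dn2 : dot n2 n2 = 1 by rewrite -sqr_enorm enorm_normalize// expr1n.
(* For unit vectors [|n1 - n2|^2 = 2 - 2 (n1 . n2)]; strict inequality gives both directional
   derivatives along [n1 - n2] their signs. *)
have dn12 : dot n1 n2 < 1.
  have : 0 < dot (n1 - n2) (n1 - n2) by rewrite lt_neqAle dot_ge0 eq_sym dot_eq0 subr_eq0 n12.
  rewrite dotDl !dotDr !dotNl !dotNr dn1 dn2 (dotC n2 n1); lra.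
have D1 : 0 < 'D_(n1 - n2) rho1 x.
  rewrite -dot_grad; last exact: d1.
  have -> : grad rho1 x = enorm (grad rho1 x) *: n1.
    by rewrite scalerA mulfV ?scale1r// enorm_eq0.
  by rewrite dotZl pmulr_rgt0 ?enorm_gt0// dotDr dotNr dn1 subr_gt0.
have D2 : 'D_(n1 - n2) rho2 x < 0.
  rewrite -dot_grad; last exact: d2.
  have -> : grad rho2 x = enorm (grad rho2 x) *: n2.
    by rewrite scalerA mulfV ?scale1r// enorm_eq0.
  by rewrite dotZl pmulr_rlt0 ?enorm_gt0// dotDr dotNr dn2 dotC subr_lt0.
have line_cvg : t *: (n1 - n2) + x @[t --> (0:R)^'+] --> x.
  suff : t *: (n1 - n2) + x @[t --> (0:R)^'+] --> (0:R) *: (n1 - n2) + x.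
    by rewrite scale0r add0r.
  apply: cvg_at_right_filter; apply: cvgD; last exact: cvg_cst.
  by apply: cvgZ; [exact: cvg_id|exact: cvg_cst].
have nU1 : \forall t \near (0:R)^'+, U1 (t *: (n1 - n2) + x).
  exact/line_cvg/open_nbhs_nbhs.
have nU2 : \forall t \near (0:R)^'+, U2 (t *: (n1 - n2) + x).
  exact/line_cvg/open_nbhs_nbhs.
near (0:R)^'+ => t.
have U1t : U1 (t *: (n1 - n2) + x) by near: t.
have U2t : U2 (t *: (n1 - n2) + x) by near: t.
have : Omega (t *: (n1 - n2) + x).
  apply/(E1 _ U1t); near: t; apply: derive_gt0_near => //; exact: d1.
move/(E2 _ U2t); apply/negP; rewrite -leNgt; apply: ltW.
near: t; apply: derive_lt0_near => //; exact: d2.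
Unshelve. all: by end_near. Qed.

(** The inner normal is chosen among the normalised gradients of all defining functions; uniqueness
    lets any one of them compute it. *)
Lemma inner_normalE Omega x U rho :
  open Omega -> frontier Omega x -> C2_defining Omega x U rho ->
  inner_normal Omega x = (enorm (grad rho x))^-1 *: grad rho x.
Proof.
move=> oO fx def.
have : is_inner_normal Omega x (inner_normal Omega x).
  by apply: getPex; exists ((enorm (grad rho x))^-1 *: grad rho x), U, rho.
move=> [U' [rho' [def' ->]]]; exact: normalized_grad_unique def' def.
Qed.

(** One defining function at [x] also serves at all nearby frontier points, so there the normal is
    the normalised gradient of a single function with continuous derivatives. *)
Lemma cvg_inner_normal Omega x : C2_domain Omega -> frontier Omega x ->
  inner_normal Omega y @[y --> within (frontier Omega) (nbhs x)]
  --> inner_normal Omega x.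
Proof.
move=> [oO _ _ hC2] fx; have [U [rho def]] := hC2 x fx.
have [oU Ux [[drho cDrho] _] _ gN0] := def.
have FF : Filter (within (frontier Omega) (nbhs x)) by exact: within_filter.
rewrite (inner_normalE oO fx def).
have nearU : \forall y \near within (frontier Omega) (nbhs x),
    (enorm (grad rho y))^-1 *: grad rho y = inner_normal Omega y.
  have : nbhs x U by exact: open_nbhs_nbhs.
  apply: filterS => y Uy fy; apply/esym/inner_normalE => //.
  exact: C2_defining_move def Uy.
apply: cvg_trans (near_eq_cvg nearU) _.
apply: cvg_normalize; first exact/eqP/gN0.
apply: cvg_within_filter.
apply: (@cvg_mx_coord _ _ (nbhs x)) => i j.
under eq_fun do rewrite mxE.
by rewrite mxE; exact: cDrho.
Qed.

End inner_normal.

(** * Borel sets and Borel functions on a normed space *)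

Section borel.
Context {R : realType} {T : normedModType R}.

Lemma measurable_open (A : set T) : open A -> measurable (A : set (borel T)).
Proof. by move=> oA; exact: sub_sigma_algebra. Qed.

Lemma measurable_closed (A : set T) : closed A -> measurable (A : set (borel T)).
Proof.
move=> cA; rewrite -[A]setCK; apply: measurableC; apply: measurable_open.
exact: closed_openC.
Qed.

Lemma within_continuous_measurable (D : set T) (f : T -> R) :
  measurable (D : set (borel T)) -> {within D, continuous f} ->
  measurable_fun (D : set (borel T)) f.
Proof.
move=> mD /continuousP cf; apply: (measurability _ (RGenOpens.measurableE R)).
move=> _ [_ [a [b ->] <-]].
have oab := @interval_open R (BRight a) (BLeft b) isT isT.
have [W oW WD] := (open_subspaceP D _).1 (cf _ oab).
by rewrite setIC -WD setIC; apply: measurableI => //; exact: measurable_open.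
Qed.

End borel.

(** * Compactness of the capillary bundle and continuity of the conormal *)

Section capillary_bundle.
Context {R : realType} {n : nat}.
Local Notation E := 'rV[R]_n.+1.
Local Notation X := ('rV[R]_n.+1 * 'M[R]_n.+1)%type.
Variables (m : nat) (Omega : set E) (beta : E -> R).
Hypotheses (hOmega : C2_domain Omega) (hbounded : bounded_set Omega)
  (hbeta : C1_hypersurface (frontier Omega) beta)
  (hbeta_range : forall x, frontier Omega x -> 0 < beta x < pi).
Local Notation S := (frontier Omega).
Local Notation bundle := (capillary_bundle m Omega beta).

Lemma compact_closure : compact (closure Omega).
Proof.
apply: bounded_closed_compact; last exact: closed_closure.
have [M [Mreal OM]] := hbounded; exists M; split => // N MN.
have cN : closed [set x : E | `|x| <= N].
  apply: (@preimage_closed _ _ (@Num.norm R E) [set r | r <= N]) => [x _|].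
    exact: norm_continuous.
  exact: closed_le.
by rewrite closureE => x; apply; split => // y /(OM N MN).
Qed.

Lemma closed_frontier : closed S.
Proof.
apply: closedI; first exact: closed_closure.
exact/open_closedC/open_interior.
Qed.

Lemma compact_frontier : compact S.
Proof. exact: (subclosed_compact closed_frontier compact_closure (@subIsetl _ _ _)). Qed.

(* [w . (nu P) = (w P) . nu = w . nu] for [w] in the plane of [P], so that the
   orthogonality condition of the bundle is automatic. *)
Lemma capillary_bundleE : bundle =
  [set p | [/\ S p.1, grassmannian m p.2 &
               enorm (inner_normal Omega p.1 *m p.2) = sin (beta p.1)]].
Proof.
apply/seteqP; split => [p [Sp gp np _]//|p [Sp gp np]]; split => // w wP wT.
have [PT _ _] := gp.
by rewrite -(dot_mul_sym _ _ PT) wP.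
Qed.

Lemma cvg_beta x : S x -> beta y @[y --> within S (nbhs x)] --> beta x.
Proof.
move=> Sx; have [U [g [oU Ux [dg _] gb]]] := hbeta Sx.
have FF : Filter (within S (nbhs x)) by exact: within_filter.
rewrite -(gb x Sx Ux).
have nearU : \forall y \near within S (nbhs x), g y = beta y.
  have : nbhs x U by exact: open_nbhs_nbhs.
  by apply: (@filterS _ (nbhs x)) => y Uy Sy; exact: gb.
apply: cvg_trans (near_eq_cvg nearU) _.
by apply: cvg_within_filter; exact: differentiable_continuous (dg x Ux).
Qed.

Lemma cvg_within_fst (p : X) (D : set X) : D `<=` (fun q => S q.1) ->
  q.1 @[q --> within D (nbhs p)] --> within S (nbhs p.1).
Proof.
move=> DS A nA; have fstA : nbhs p _ := @cvg_fst _ _ (nbhs p.1) (nbhs p.2) _ _ nA.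
suff : nbhs p (fun q : X => D q -> A q.1) by [].
by apply: filterS (fstA _) => q qA /DS; exact: qA.
Qed.

Lemma cvg_within_projection (p : X) (D : set X) : S p.1 -> D `<=` (fun q => S q.1) ->
  inner_normal Omega q.1 *m q.2 @[q --> within D (nbhs p)]
  --> inner_normal Omega p.1 *m p.2.
Proof.
move=> Sp DS; have FF : Filter (within D (nbhs p)) by exact: within_filter.
apply: cvg_mulmx; last first.
  by apply: cvg_within_filter; exact: (@cvg_snd _ _ (nbhs p.1) (nbhs p.2)).
apply: (cvg_comp (fun q : X => q.1) (inner_normal Omega)).
  exact: cvg_within_fst.
exact: cvg_inner_normal.
Qed.

(** The conditions on position and plane are closed. They come first because the normal and [beta]
    are only known to converge at frontier points; the norm equation then passes to the limit. *)
Lemma closed_capillary_bundle : closed bundle.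
Proof.
rewrite capillary_bundleE; set D := mkset _ => p clp.
have DS : D `<=` (fun q => S q.1) by move=> q [].
have closedDp (C : set X) : closed C -> D `<=` C -> C p.
  by move=> cC DC; move: clp; rewrite closureE; apply.
have Sp : S p.1.
  apply: (closedDp (fst @^-1` S)) => //.
  apply: preimage_closed closed_frontier => q _.
  exact: (@cvg_fst _ _ (nbhs q.1) (nbhs q.2)).
have gp : grassmannian m p.2.
  apply: (closedDp (snd @^-1` (@grassmannian R n m))); last by move=> q [].
  apply: preimage_closed (@closed_grassmannian _ _ m) => q _.
  exact: (@cvg_snd _ _ (nbhs q.1) (nbhs q.2)).
split => //.
(* Properness holds because [p] lies in the closure of [D]; it is what makes the two limits below
   coincide. *)
have PF : ProperFilter (within D (nbhs p)) by exact: within_nbhs_proper.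
have cvg_l := cvg_enorm (cvg_within_projection Sp DS).
have cvg_r : sin (beta q.1) @[q --> within D (nbhs p)] --> sin (beta p.1).
  apply: (cvg_comp (fun q : X => beta q.1) sin); last exact: continuous_sin.
  apply: (cvg_comp (fun q : X => q.1) beta); last exact: cvg_beta.
  exact: cvg_within_fst.
have nearD : \forall q \near within D (nbhs p),
    enorm (inner_normal Omega q.1 *m q.2) = sin (beta q.1).
  by apply: filterS (@filterT _ _ (nbhs_filter p)) => q _ [].
exact: (cvg_unique (@Rhausdorff R) (cvg_trans (near_eq_cvg nearD) (cvg_l _)) cvg_r).
Qed.

Lemma capillary_bundle_sub_Gr : bundle `<=` Gr m S.
Proof. by move=> p [Sp gp _ _]. Qed.

Lemma compact_capillary_bundle : compact bundle.
Proof.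
apply: (subclosed_compact closed_capillary_bundle (compact_Gr _)) => //.
- exact: compact_frontier.
- exact: capillary_bundle_sub_Gr.
Qed.

Lemma projection_neq0 p : bundle p -> inner_normal Omega p.1 *m p.2 != 0.
Proof.
move=> [Sp _ np _]; rewrite -enorm_gt0 np.
by apply: sin_gt0_pi; exact: hbeta_range.
Qed.

Lemma enorm_conormal p : bundle p -> enorm (conormal Omega p) = 1.
Proof. by move=> /projection_neq0; exact: enorm_normalize. Qed.

Lemma conormal_continuous : {within bundle, continuous (conormal Omega)}.
Proof.
apply/subspace_continuousP => p bp.
have FF : Filter (within bundle (nbhs p)) by exact: within_filter.
apply: cvg_normalize; first exact: projection_neq0.
have [Sp _ _ _] := bp.
by apply: cvg_within_projection => // q [].
Qed.

Lemma measurable_capillary_bundle : measurable (bundle : set (borel X)).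
Proof. exact: (@measurable_closed R X bundle (@closed_capillary_bundle)). Qed.

Lemma measurable_conormal j :
  measurable_fun (bundle : set (borel X)) (fun p => conormal Omega p 0 j).
Proof.
apply: within_continuous_measurable; first exact: measurable_capillary_bundle.
apply/subspace_continuousP => p bp.
have FF : Filter (within bundle (nbhs p)) by exact: within_filter.
by apply: cvg_coord; have /subspace_continuousP := conormal_continuous; exact.
Qed.

End capillary_bundle.

(** * Countable partition into grid cells *)

Section floor_cells.
Context {d} {T : measurableType d} {R : realType} {I : finType}.
Variable g : I -> T -> R.

(** The tuple of integer parts is coded by a natural number, so that the cells form a sequence of
    sets as in the definition of total variation. *)
Definition floor_cell (i : nat) : set T :=
  [set x | pickle [ffun j => Num.floor (g j x)] = i].

Lemma trivIset_floor_cell : trivIset setT floor_cell.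
Proof. by move=> i j _ _ [x [<- <-]]. Qed.

Lemma bigcup_floor_cell : \bigcup_i floor_cell i = setT.
Proof. by apply/seteqP; split => // x _; exists (pickle [ffun j => Num.floor (g j x)]). Qed.

Lemma floor_cell_close i j x y :
  floor_cell i x -> floor_cell i y -> `|g j x - g j y| <= 1.
Proof.
rewrite /floor_cell /= => <- /(pcan_inj pickleK)/ffunP/(_ j); rewrite !ffunE => xy.
have := floor_itv (g j x); have := floor_itv (g j y); rewrite xy intrD.
by move=> /andP[? ?] /andP[? ?]; rewrite ler_norml; apply/andP; split; lra.
Qed.

Lemma measurable_floor_cell i : (forall j, measurable_fun setT (g j)) ->
  measurable (floor_cell i).
Proof.
move=> mg.
(* An index that codes no tuple has an empty cell; otherwise the cell is a finite intersection of
   preimages of half-open unit intervals. *)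
have [[z zi]|noz] := pselect (exists z : {ffun I -> int}, pickle z = i); last first.
  suff -> : floor_cell i = set0 by [].
  by rewrite -subset0 => x xi; apply: noz; eexists; exact: xi.
have -> : floor_cell i =
    \bigcap_(j in [set` enum I]) (g j @^-1` `[(z j)%:~R, (z j + 1)%:~R[%classic).
  apply/seteqP; split => [x xi j _ | x xz].
    have /ffunP/(_ j) : [ffun j => Num.floor (g j x)] = z.
      by apply: (pcan_inj pickleK); rewrite zi.
    by rewrite ffunE => <-; rewrite /= in_itv/=; exact: floor_itv.
  rewrite /floor_cell /= -zi; congr pickle; apply/ffunP => j; rewrite ffunE.
  apply: floor_def; have := xz j; rewrite /= in_itv/=; apply.
  by rewrite mem_enum.
apply: fin_bigcap_measurable => // j _.
by rewrite -[X in measurable X]setTI; exact: mg.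
Qed.

End floor_cells.

(** * Vector measures whose density is a field of unit vectors *)

Section unit_density.
Context {d} {T : measurableType d} {R : realType} {k : nat}.
Variables (mu : {measure set T -> \bar R}) (D : set T) (nu : T -> 'rV[R]_k).
Hypotheses (mu_fin : (mu setT < +oo)%E) (mD : measurable D) (muD : mu (~` D) = 0%E)
  (mnu : forall j, measurable_fun setT (fun p => nu p 0 j))
  (nu1 : forall p, D p -> enorm (nu p) = 1) (nu0 : forall p, ~ D p -> nu p = 0).

Definition vector_density (A : set T) : 'rV[R]_k :=
  \row_j \int[mu]_(p in A) (nu p 0 j).

Lemma measure_fin A : measurable A -> (mu A < +oo)%E.
Proof. by move=> mA; apply: le_lt_trans mu_fin; apply: le_measure; rewrite ?inE. Qed.

Lemma measure_setI_support A : measurable A -> mu (A `&` D) = mu A.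
Proof.
move=> mA; rewrite [RHS](@measureDI _ _ _ mu A D)// -[LHS]add0e; congr (_ + _)%E.
apply/esym/eqP; rewrite -measure_le0 -muD; apply: le_measure; rewrite ?inE.
- exact: measurableD.
- exact: measurableC.
- by move=> x [].
Qed.

Lemma norm_density_le1 p j : `|nu p 0 j| <= 1.
Proof.
have [Dp|/nu0->] := pselect (D p); last by rewrite mxE normr0.
have: nu p 0 j ^+ 2 <= 1.
  rewrite -[leRHS](expr1n _ 2) -(nu1 Dp) sqr_enorm /dot (bigD1 j)//= -expr2 lerDl.
  by apply: sumr_ge0 => i _; rewrite -expr2 sqr_ge0.
by rewrite -real_normK ?num_real// expr_le1.
Qed.

Lemma bounded_integrable (f : T -> R) A : measurable A -> measurable_fun setT f ->
  (exists M, forall p, `|f p| <= M) -> mu.-integrable A (EFin \o f).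
Proof.
move=> mA mf [M fM]; apply: measurable_bounded_integrable => //.
- exact: measure_fin.
- exact: measurable_funTS.
- exists M; split; first exact: num_real.
  by move=> N MN p _ /=; exact: le_trans (fM p) (ltW MN).
Qed.

Lemma integrable_density A j : measurable A ->
  mu.-integrable A (EFin \o (fun p => nu p 0 j)).
Proof.
by move=> mA; apply: bounded_integrable => //; exists 1 => p; exact: norm_density_le1.
Qed.

Lemma dot_density_le (u : 'rV[R]_k) p : enorm u = 1 -> `|dot u (nu p)| <= 1.
Proof.
move=> u1; have [Dp|/nu0->] := pselect (D p); last first.
  by rewrite -(scale0r u) dotZr mul0r normr0.
have enormN : enorm (- u) = enorm u by rewrite /enorm dotNl dotNr opprK.
by rewrite ler_norml lerNl -dotNl -u1 -{1}enormN !dot_le_unit// nu1.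
Qed.

Lemma integrable_dot_density u A : measurable A ->
  mu.-integrable A (EFin \o (fun p => dot u (nu p))).
Proof.
move=> mA; have -> : EFin \o (fun p => dot u (nu p)) =
    (fun p => \sum_j (u 0 j * nu p 0 j)%:E)%E.
  by apply/funext => p; rewrite sumEFin.
apply: integrable_sum => // j _.
apply: (bounded_integrable mA); first exact: measurable_funM.
exists `|u 0 j| => p; rewrite normrM ler_piMr//; exact: norm_density_le1.
Qed.

Lemma dot_vector_density u A : measurable A ->
  dot u (vector_density A) = \int[mu]_(p in A) dot u (nu p).
Proof.
move=> mA; rewrite /Rintegral.
under eq_integral do rewrite /dot -sumEFin.
rewrite integral_sum//; last first.
  move=> j; apply: (bounded_integrable mA); first exact: measurable_funM.
  exists `|u 0 j| => p; rewrite normrM ler_piMr//; exact: norm_density_le1.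
rewrite -sum_fine; last first.
  move=> j _; apply: integrable_fin_num => //.
  apply: (bounded_integrable mA); first exact: measurable_funM.
  exists `|u 0 j| => p; rewrite normrM ler_piMr//; exact: norm_density_le1.
apply: eq_bigr => j _; rewrite mxE -RintegralZl//; exact: integrable_density.
Qed.

(** Test the vector against its own direction [w]: its norm is the integral of [dot w (nu p)], an
    integrand bounded by 1. *)
Lemma enorm_vector_density_le A : measurable A ->
  ((enorm (vector_density A))%:E <= mu A)%E.
Proof.
move=> mA; have [->|v0] := eqVneq (vector_density A) 0.
  by rewrite (_ : enorm 0 = 0) ?measure_ge0//; apply/eqP; rewrite enorm_eq0.
set v := vector_density A in v0 *; pose w := (enorm v)^-1 *: v.
have w1 : enorm w = 1 by exact: enorm_normalize.
have -> : enorm v = dot w v.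
  by rewrite dotZl -sqr_enorm expr2 mulKf// enorm_eq0.
have muA : mu A \is a fin_num by rewrite ge0_fin_numE//; exact: measure_fin.
rewrite dot_vector_density// -(fineK muA) lee_fin.
have -> : fine (mu A) = \int[mu]_(p in A) 1 by rewrite Rintegral_cst// mul1r.
apply: le_Rintegral => //.
- exact: integrable_dot_density.
- by apply: bounded_integrable => //; exists 1 => p; rewrite normr1.
- by move=> p _; have := dot_density_le p w1; rewrite ler_norml => /andP[].
Qed.

(** Test against the unit vector [nu q] at one point [q] of [F] in [D]: small oscillation keeps
    [dot (nu q) (nu p)] close to 1 for [p] in [F] and [D], and [D] carries all the mass. *)
Lemma enorm_vector_density_ge F (delta : R) : measurable F ->
  (forall p q j, F p -> F q -> `|nu p 0 j - nu q 0 j| <= delta) ->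
  ((1 - k%:R * delta ^+ 2)%:E * mu F <= (enorm (vector_density F))%:E)%E.
Proof.
move=> mF osc.
have mFD : measurable (F `&` D) by exact: measurableI.
have [FD0|/set0P[q [Fq Dq]]] := eqVneq (F `&` D) set0.
  by rewrite -measure_setI_support// FD0 measure0 mule0 lee_fin enorm_ge0.
have muFD : mu (F `&` D) \is a fin_num by rewrite ge0_fin_numE//; exact: measure_fin.
rewrite -measure_setI_support// -(fineK muFD) -EFinM lee_fin.
apply: le_trans (dot_le_unit _ (nu1 Dq)); rewrite dotC dot_vector_density//.
rewrite -Rintegral_cst//.
have -> : \int[mu]_(p in F) dot (nu q) (nu p) = \int[mu]_(p in F `&` D) dot (nu q) (nu p).
  rewrite Rintegral_mkcondr; apply: eq_Rintegral => p _; rewrite /patch.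
  by case: ifPn => // /negP; rewrite inE => /nu0 ->; rewrite -(scale0r (nu q)) dotZr mul0r.
apply: le_Rintegral => //.
- apply: (bounded_integrable mFD) => //; exists `|1 - k%:R * delta ^+ 2| => p; exact: lexx.
- exact: integrable_dot_density.
move=> p [Fp Dp].
(* For unit vectors, [2 (1 - a . b) = |a - b|^2]. *)
have : dot (nu q - nu p) (nu q - nu p) <= k%:R * delta ^+ 2.
  rewrite /dot; apply: le_trans (_ : \sum_(j < k) delta ^+ 2 <= _).
    apply: ler_sum => j _; rewrite !mxE -expr2 -real_normK ?num_real//.
    by rewrite ler_pXn2r ?nnegrE//; [exact: osc|exact: le_trans (osc _ _ j Fq Fp)].
  by rewrite sumr_const card_ord mulr_natl.
(* This yields the bound [1 - k delta^2 / 2], which is then weakened by dropping the factor one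
   half. *)
rewrite dotDl !dotDr !dotNl !dotNr -!sqr_enorm !nu1// (dotC (nu p)) expr1n.
have := sqr_ge0 delta; have : 0 <= k%:R :> R by []; nra.
Qed.

End unit_density.

(** * Jordan parts of a real measure with a bounded density *)

Section signed_integral_density.
Context {R : realType} {n : nat}.
Local Notation X := ('rV[R]_n.+1 * 'M[R]_n.+1)%type.
Variables (mu : {measure set (borel X) -> \bar R}) (D K : set X).
Hypotheses (mu_fin : (mu setT < +oo)%E) (cK : compact K) (KD : K `<=` D)
  (mK : measurable (K : set (borel X))).

(** No admissible set exceeds the integral of the positive part of [h]. The value is attained on the
    part of [A] in [K] where [h >= 0]: [K] makes this set relatively compact, and nothing is lost as
    [h] vanishes off [K]. *)
Lemma positive_part_density (h : X -> R) (nu : set X -> R) (A : set X) :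
  measurable_fun (setT : set (borel X)) h -> (exists M, forall p, `|h p| <= M) ->
  (forall p, ~ K p -> h p = 0) ->
  (forall C, measurable (C : set (borel X)) -> nu C = \int[mu]_(p in C) h p) ->
  measurable (A : set (borel X)) ->
  positive_part D nu A = (\int[mu]_(p in A) (Num.max (h p) 0)%:E)%E.
Proof.
move=> mh bh h0 nuE mA.
have mmax C : measurable_fun (C : set (borel X)) (fun p => (Num.max (h p) 0)%:E).
  by apply: measurable_funTS; apply/measurable_EFinP; exact: measurable_maxr.
have max_ge0 (p : X) : (0 <= (Num.max (h p) 0)%:E)%E by rewrite lee_fin le_max lexx orbT.
have nuEF C : measurable (C : set (borel X)) -> (nu C)%:E = (\int[mu]_(p in C) (h p)%:E)%E.
  move=> mC; rewrite nuE// /Rintegral fineK//; apply: integrable_fin_num => //.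
  exact: (bounded_integrable mu_fin).
apply/eqP; rewrite eq_le; apply/andP; split.
  apply: ge_ereal_sup => _ [C [mC CA _] <-]; rewrite nuEF//.
  apply: (@le_trans _ _ (\int[mu]_(p in C) (Num.max (h p) 0)%:E)%E).
    apply: le_integral => //.
    - exact: (bounded_integrable mu_fin).
    - apply: (bounded_integrable mu_fin) => //; first exact: measurable_maxr.
      have [M hM] := bh; exists M => p; apply: le_trans (hM p).
      by rewrite ger0_norm ?le_max ?lexx ?orbT// ge_max ler_norm normr_ge0.
    - by move=> p _; rewrite lee_fin le_max lexx.
  exact: ge0_subset_integral.
pose C := A `&` (K `&` [set p | 0 <= h p]).
have mh0 : measurable ([set p | 0 <= h p] : set (borel X)).
  rewrite (_ : mkset _ = setT `&` h @^-1` `[0, +oo[%classic); first exact: mh.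
  by rewrite setTI; apply/seteqP; split => p /=; rewrite in_itv/= andbT.
have mC : measurable (C : set (borel X)) by apply: measurableI => //; exact: measurableI.
apply: ereal_sup_ubound; exists C.
  by split => //; [exact: subIsetl|exists K; split => // p [_ []]].
rewrite nuEF// /C integral_mkcondr; apply: eq_integral => p _; rewrite patchE.
case: ifPn => [|/negP]; rewrite inE; first by move=> [_ /max_idPl ->].
move=> /not_andP[/h0->|/negP]; first by rewrite maxxx.
by rewrite -ltNge => /ltW/max_idPr ->.
Qed.

(** The two Jordan parts have densities [max h 0] and [max (- h) 0], whose difference is [h].
    Boundedness of [f * h] and finiteness of [mu] make both integrals finite, so they may be
    subtracted. *)
Lemma signed_integral_density (h f : X -> R) (nu : set X -> R) :
  measurable (D : set (borel X)) ->
  measurable_fun (setT : set (borel X)) h -> (exists M, forall p, `|h p| <= M) ->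
  (forall p, ~ K p -> h p = 0) ->
  (forall C, measurable (C : set (borel X)) -> nu C = \int[mu]_(p in C) h p) ->
  measurable_fun (setT : set (borel X)) f -> (exists M, forall p, `|f p * h p| <= M) ->
  signed_integral D nu f = (\int[mu]_(p in D) (f p * h p)%:E)%E.
Proof.
move=> mD mh bh h0 nuE mf bfh.
have half (g : X -> R) (nu' : set X -> R) :
    measurable_fun (setT : set (borel X)) g -> (exists M, forall p, `|g p| <= M) ->
    (forall p, ~ K p -> g p = 0) ->
    (forall C, measurable (C : set (borel X)) -> nu' C = \int[mu]_(p in C) g p) ->
    integral (positive_part D nu' : set (borel X) -> \bar R) D (fun p => (f p)%:E) =
    (\int[mu]_(p in D) (f p * Num.max (g p) 0)%:E)%E.
  move=> mg bg g0 nu'E.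
  have mg' : measurable_fun (setT : set (borel X)) (fun p => Num.max (g p) 0).
    exact: measurable_maxr.
  have g'0 (p : X) : 0 <= Num.max (g p) 0 by rewrite le_max lexx orbT.
  rewrite -(integral_density mu mg' g'0 mD mf).
  by apply: integral_eq_set_function => A mA; exact: (positive_part_density mg).
rewrite /signed_integral (half _ _ mh bh h0 nuE) (half (fun p => - h p)); first last.
- move=> C mC; rewrite nuE//.
  under [RHS]eq_Rintegral do rewrite -mulN1r.
  by rewrite RintegralZl ?mulN1r//; exact: (bounded_integrable mu_fin).
- by move=> p /h0 ->; rewrite oppr0.
- by have [M hM] := bh; exists M => p; rewrite normrN.
- exact: measurableT_comp.
have int_half (s : X -> R) : measurable_fun (setT : set (borel X)) s ->
    (forall p, `|s p| <= `|h p|) -> mu.-integrable D (EFin \o (fun p => f p * s p)).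
  move=> ms sh; apply: (bounded_integrable mu_fin) => //; first exact: measurable_funM.
  have [M fhM] := bfh; exists M => p; apply: le_trans (fhM p).
  by rewrite !normrM ler_wpM2l.
rewrite -integralB_EFin//.
- apply: eq_integral => p _; rewrite -EFinB -mulrBr; congr (f p * _)%:E.
  by have [hp|hp] := leP 0 (h p); [rewrite (max_idPr _)|rewrite (max_idPl _)];
    rewrite ?oppr_le0 ?oppr_ge0 ?(ltW hp)// ?subr0 ?sub0r ?opprK.
- apply: int_half => [|p]; first exact: measurable_maxr.
  by rewrite ger0_norm ?le_max ?lexx ?orbT// ge_max ler_norm normr_ge0.
- apply: int_half => [|p]; first by apply: measurable_maxr => //; exact: measurableT_comp.
  by rewrite ger0_norm ?le_max ?lexx ?orbT// ge_max -normrN ler_norm normr_ge0.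
Qed.

End signed_integral_density.

Lemma closed_Gr {R : realType} {n m : nat} (U : set 'rV[R]_n.+1) :
  closed U -> closed (Gr m U).
Proof.
move=> cU; apply: closedI.
  apply: preimage_closed cU => p _.
  exact: (@cvg_fst _ _ (nbhs p.1) (nbhs p.2)).
apply: preimage_closed (@closed_grassmannian _ _ m) => p _.
exact: (@cvg_snd _ _ (nbhs p.1) (nbhs p.2)).
Qed.

(** * Countable additivity of a vector measure with integrable density *)

Section vector_density_sigma_additive.
Context {d} {T : measurableType d} {R : realType} {k : nat}.
Variables (mu : {measure set T -> \bar R}) (nu : T -> 'rV[R]_k).
Hypothesis inu : forall j, mu.-integrable setT (EFin \o (fun p => nu p 0 j)).

Lemma vector_density_sigma_additive (F : nat -> set T) :
  (forall i, measurable (F i)) -> trivIset setT F ->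
  (fun N => \sum_(i < N) vector_density mu nu (F i)) @ \oo -->
  vector_density mu nu (\bigcup_i F i).
Proof.
move=> mF tF; apply: cvg_mx_coord => i j; rewrite ord1 {i} mxE.
have mUF : measurable (\bigcup_i F i) by exact: bigcup_measurable.
have fin A : measurable A -> (\int[mu]_(p in A) (nu p 0 j)%:E)%E \is a fin_num.
  by move=> mA; apply: integrable_fin_num => //; exact: integrableS (inu j).
(* Each coordinate is a charge with extended real values; finiteness of these values brings the
   convergence back to the reals. *)
have /fine_cvg : ((fun N => \sum_(0 <= i < N) induced_charge (inu j) (F i)) @ \oo -->
    (\int[mu]_(p in \bigcup_i F i) (nu p 0 j))%:E)%E.
  by rewrite /Rintegral fineK ?fin//; exact: charge_semi_sigma_additive.
apply: cvg_trans; apply: near_eq_cvg; apply: nearW => N /=.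
rewrite summxE big_mkord -sum_fine; last by move=> i _; exact: fin.
by apply: eq_bigr => i _; rewrite mxE.
Qed.

End vector_density_sigma_additive.

(** * The boundary measure: total variation and integration against it *)

Section conormal_measure.
Context {R : realType} {n : nat}.
Local Notation E := 'rV[R]_n.+1.
Local Notation X := ('rV[R]_n.+1 * 'M[R]_n.+1)%type.
Variables (m : nat) (Omega : set E) (beta : E -> R).
Variable Gamma : {measure set (borel X) -> \bar R}.
Hypotheses (hOmega : C2_domain Omega) (hbounded : bounded_set Omega)
  (hbeta : C1_hypersurface (frontier Omega) beta)
  (hbeta_range : forall x, frontier Omega x -> 0 < beta x < pi)
  (hGamma : radon_on (capillary_bundle m Omega beta) Gamma).
Local Notation S := (frontier Omega).
Local Notation bundle := (capillary_bundle m Omega beta).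

(** Extension by zero turns integrals over the trace of a set on the bundle into integrals over the
    set itself, with a density that is Borel on the whole space. *)
Definition conormal0 (p : X) : E := if p \in bundle then conormal Omega p else 0.

Let mbundle : measurable (bundle : set (borel X)).
Proof. exact: measurable_capillary_bundle. Qed.

Let cbundle : compact bundle.
Proof. exact: compact_capillary_bundle. Qed.

Let GammaD : Gamma (~` bundle) = 0%E. Proof. by case: hGamma. Qed.

Let Gamma_fin : (Gamma setT < +oo)%E.
Proof.
have -> : Gamma setT = (Gamma bundle + Gamma (~` bundle))%E.
  by rewrite -measureU ?setUv//; [exact: measurableC|exact: setICr].
by rewrite GammaD adde0; case: hGamma => + _; apply.
Qed.

Let nu1 p : bundle p -> enorm (conormal0 p) = 1.
Proof. by move=> bp; rewrite /conormal0 mem_set//; exact: enorm_conormal bp. Qed.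

Let nu0 p : ~ bundle p -> conormal0 p = 0.
Proof. by move=> bp; rewrite /conormal0 memNset. Qed.

Let mnu j : measurable_fun (setT : set (borel X)) (fun p => conormal0 p 0 j).
Proof.
rewrite (_ : (fun _ => _) = (fun p => conormal Omega p 0 j) \_ bundle).
  by apply: (measurable_restrictT _ mbundle).1; exact: measurable_conormal.
by apply/funext => p; rewrite /conormal0 patchE; case: ifP => // _; rewrite mxE.
Qed.

Lemma conormal_measureE A :
  conormal_measure m Omega beta Gamma A = vector_density Gamma conormal0 A.
Proof.
apply/rowP => j; rewrite !mxE Rintegral_mkcondr; apply: eq_Rintegral => p _.
by rewrite /conormal0 patchE; case: ifP => // _; rewrite mxE.
Qed.

Lemma vector_radon_on_conormal_measure (D : set X) :
  vector_radon_on D (conormal_measure m Omega beta Gamma).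
Proof.
move=> K _ _ F mF tF; rewrite conormal_measureE.
under eq_fun do under eq_bigr do rewrite conormal_measureE.
apply: vector_density_sigma_additive => //; last by move=> i; exact: (mF i).1.
by move=> j; apply: (integrable_density Gamma_fin _ nu1 nu0).
Qed.

(** Since the Grassmannian is compact, only the position has to be bounded. *)
Lemma relatively_compact_in_Gr (A : set X) (M : R) :
  A `<=` Gr m setT -> (forall p, A p -> `|p.1| <= M) ->
  relatively_compact_in (Gr m setT) A.
Proof.
move=> AG AM; exists (Gr m [set x | `|x| <= M]); split.
- apply: compact_Gr; apply: bounded_closed_compact.
    exists M; split; first exact: num_real.
    by move=> N /ltW MN x /= /le_trans; exact.
  apply: (@preimage_closed _ _ (@Num.norm R E) [set r | r <= M]) => [x _|].
    exact: norm_continuous.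
  exact: closed_le.
- by move=> p [_ ?]; split.
- by move=> p Ap; split; [exact: AM|exact: (AG p Ap).2].
Qed.

Lemma vector_total_variation_conormal_measure (A : set X) :
  measurable (A : set (borel X)) -> A `<=` Gr m setT ->
  vector_total_variation (Gr m setT) (conormal_measure m Omega beta Gamma) A
  = Gamma A.
Proof.
move=> mA AG; apply/eqP; rewrite eq_le; apply/andP; split.
  (* Upper bound: on each piece the norm of the vector is at most the mass, and the masses add up to
     [Gamma A]. *)
  apply: ge_ereal_sup => _ [F [mF _ tF <-] <-].
  rewrite measure_semi_bigcup//; last by apply: bigcup_measurable.
  apply: lee_nneseries => [i _ _|i _]; first by rewrite lee_fin enorm_ge0.
  by rewrite conormal_measureE; apply: (enorm_vector_density_le Gamma_fin mnu nu1 nu0).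
have GA : Gamma A \is a fin_num by rewrite ge0_fin_numE//; exact: (measure_fin Gamma_fin).
apply/lee_addgt0Pr => e e0.
pose a := fine (Gamma A); have a0 : 0 <= a by rewrite fine_ge0.
pose c : R := a + 1.
(* Adding 1 to [a] allows the division when [Gamma A = 0]. With [N = n + 1], [N delta <= 1] and
   [delta c <= e] give [N delta^2 a <= delta a <= e], and also [N delta^2 <= 1], so the factor
   [1 - N delta^2] is nonnegative. *)
have c0 : 0 < c by rewrite ltr_wpDl.
pose delta := Num.min n.+1%:R^-1 (e / c).
have delta0 : 0 < delta by rewrite lt_min invr_gt0 ltr0Sn divr_gt0.
have delta1 : n.+1%:R * delta <= 1.
  by rewrite -ler_pdivlMl ?ltr0Sn// mulr1 ge_min lexx.
have delta_le1 : n.+1%:R * delta ^+ 2 <= 1.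
  have : 1 <= n.+1%:R :> R by rewrite ler1n.
  nra.
have delta_e : n.+1%:R * delta ^+ 2 * a <= e.
  have : delta * c <= e by rewrite -ler_pdivlMr// ge_min lexx orbT.
  have : 0 <= (1 - n.+1%:R * delta) * (delta * a).
    by rewrite mulr_ge0 ?subr_ge0// mulr_ge0// ltW.
  rewrite /c; nra.
(* The coordinate [None] makes the cells bounded, hence relatively compact. *)
pose g : option 'I_n.+1 -> borel X -> R := fun o (p : X) =>
  if o is Some j then delta^-1 * conormal0 p 0 j else `|p.1|.
have mg o : measurable_fun (setT : set (borel X)) (g o).
  case: o => [j|] /=; first exact: measurable_funM.
  apply: within_continuous_measurable => //; apply: continuous_subspaceT => p.
  apply: (cvg_comp (fun q : X => q.1) (@Num.norm R E)); last exact: norm_continuous.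
  exact: (@cvg_fst _ _ (nbhs p.1) (nbhs p.2)).
pose F i := A `&` floor_cell g i.
have mF i : measurable (F i : set (borel X)).
  by apply: measurableI => //; exact: measurable_floor_cell.
have tF : trivIset setT F.
  move=> i j _ _ [p [[_ Fi] [_ Fj]]].
  by apply: (@trivIset_floor_cell _ _ _ _ g) => //; exists p.
have UF : \bigcup_i F i = A by rewrite -setI_bigcupr (bigcup_floor_cell g) setIT.
have rF i : relatively_compact_in (Gr m setT) (F i).
  have [->|/set0P[q [_ Fq]]] := eqVneq (F i) set0.
    by exists set0; split => //; exact: compact0.
  apply: (@relatively_compact_in_Gr _ (`|q.1| + 1)) => [p [/AG]//|p [_ Fp]].
  have := floor_cell_close None Fp Fq.
  by rewrite ler_norml => /andP[_]; rewrite lerBlDl.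
(* The chain is [Gamma A <= (1 - N delta^2) Gamma A + e], then the sum over the cells plus [e], then
   the supremum plus [e]. *)
apply: (@le_trans _ _ ((\sum_(i <oo)
    (enorm (conormal_measure m Omega beta Gamma (F i)))%:E) + e%:E)%E); last first.
  by rewrite leeD2r//; apply: ereal_sup_ubound; exists F.
apply: (@le_trans _ _ ((1 - n.+1%:R * delta ^+ 2)%:E * Gamma A + e%:E)%E).
  by rewrite -(fineK GA) -EFinM -EFinD lee_fin -/a; lra.
rewrite leeD2r// -{1}UF measure_semi_bigcup//; last by rewrite UF.
rewrite -nneseriesZl//; apply: lee_nneseries => [i _ _|i _].
  by rewrite mule_ge0// lee_fin subr_ge0.
rewrite conormal_measureE.
apply: (enorm_vector_density_ge Gamma_fin mbundle GammaD mnu nu1 nu0) => //.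
(* Coordinates scaled by [1 / delta] differ by at most 1 on a cell, hence the coordinates themselves
   by at most [delta]. *)
move=> p q j [_ Fp] [_ Fq]; have := floor_cell_close (Some j) Fp Fq.
rewrite /g /= -mulrBr normrM (gtr0_norm (x := delta^-1)) ?invr_gt0//.
by rewrite ler_pdivrMl// mulr1.
Qed.


(** On the compact bundle the continuous [phi] is bounded, and off it [conormal0] vanishes. So each
    coordinate falls under [signed_integral_density], and the coordinates sum to the inner
    product. *)
Lemma vector_integral_conormal_measure (phi : X -> E) : continuous phi ->
  vector_integral (Gr m setT) (conormal_measure m Omega beta Gamma) phi =
  (\int[Gamma]_(p in bundle) (dot (conormal Omega p) (phi p))%:E)%E.
Proof.
move=> cphi.
have cphij j : continuous (fun p => phi p 0 j).
  by move=> p; apply: (@cvg_coord _ _ (nbhs p)); exact: cphi.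
have mphij j : measurable_fun (setT : set (borel X)) (fun p => phi p 0 j).
  by apply: within_continuous_measurable => //; exact: continuous_subspaceT.
have mG : measurable (Gr m setT : set (borel X)).
  by apply: measurable_closed; apply: closed_Gr; exact: closedT.
have bundleG : bundle `<=` Gr m setT by move=> p [_ gp _ _]; split.
have norm_nu j p : `|conormal0 p 0 j| <= 1.
  exact: (@norm_density_le1 _ (borel X) _ _ _ _ nu1 nu0).
have bphi j : exists M, forall p, `|phi p 0 j * conormal0 p 0 j| <= M.
  have : compact ((fun p => phi p 0 j) @` bundle).
    by apply: continuous_compact cbundle; exact: continuous_subspaceT.
  (* Boundedness provides a bound only for numbers strictly above [M], hence [M + 1]. *)
  move=> /compact_bounded[M [Mreal hM]]; exists `|M + 1| => p.
  have [bp|/nu0->] := pselect (bundle p); last by rewrite mxE mulr0 normr0.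
  rewrite normrM (le_trans (ler_piMr _ (norm_nu j p)))//.
  apply: le_trans (ler_norm _); apply: (hM (M + 1)); first by rewrite ltrDl.
  by exists p.
transitivity (\sum_j \int[Gamma]_(p in Gr m setT) (phi p 0 j * conormal0 p 0 j)%:E)%E.
  apply: eq_bigr => j _.
  apply: (signed_integral_density Gamma_fin cbundle bundleG mbundle) => //.
  - by exists 1 => p.
  - by move=> p /nu0 ->; rewrite mxE.
  - by move=> C _; rewrite conormal_measureE mxE.
rewrite -integral_sum//; last first.
  move=> j; apply: (bounded_integrable Gamma_fin) => //; exact: measurable_funM.
rewrite integral_mkcond [RHS]integral_mkcond; apply: eq_integral => p _.
rewrite !patchE; case: ifPn => [pG|].
  rewrite sumEFin; case: ifPn => [/set_mem bp|/negP]; last first.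
    rewrite inE => /nu0 p0; rewrite big1// => j _.
    by rewrite p0 mxE mulr0.
  congr EFin; apply: eq_bigr => j _.
  by rewrite /conormal0 mem_set// mulrC.
by case: ifPn => // /set_mem/bundleG/mem_set ->.
Qed.

End conormal_measure.

(** * From varifolds on a compact set to varifolds on the whole space *)

Section varifolds_on_a_compact_set.
Context {R : realType} {n m : nat}.
Local Notation E := 'rV[R]_n.+1.
Local Notation X := ('rV[R]_n.+1 * 'M[R]_n.+1)%type.
Variables (C : set E) (V : {measure set (borel X) -> \bar R}).
Hypotheses (cC : compact C) (VC : varifold m C V).

Let closedC : closed C.
Proof. exact: compact_closed (@norm_hausdorff _ _) cC. Qed.

Let mGrC : measurable (Gr m C : set (borel X)).
Proof. exact: (measurable_closed (closed_Gr closedC)). Qed.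

Let mGrT : measurable (Gr m setT : set (borel X)).
Proof. exact: (measurable_closed (closed_Gr closedT)). Qed.

Let GrCT : Gr m C `<=` Gr m setT.
Proof. by move=> p [_ ?]; split. Qed.

(** All the mass lies on [Gr m C], which is compact and so has finite measure; this bounds the mass
    of every compact set. *)
Lemma varifold_setT : varifold m setT V.
Proof.
have [Vfin V0] := VC; split => [K cK KG|].
  have mK : measurable (K : set (borel X)).
    by apply: measurable_closed; exact: compact_closed (@norm_hausdorff _ _) cK.
  apply: (@le_lt_trans _ _ (V (Gr m C) + V (~` Gr m C))%E).
    rewrite -measureU ?setUv ?setICr//; last exact: measurableC.
    by apply: le_measure; rewrite ?inE.
  by rewrite V0 adde0; apply: Vfin => //; exact: compact_Gr.
apply/eqP; rewrite -measure_le0 -V0; apply: le_measure; rewrite ?inE.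
- exact: measurableC.
- exact: measurableC.
- exact: subsetC.
Qed.

Lemma integral_Gr_setT (f : X -> \bar R) :
  (\int[V]_(p in Gr m setT) f p = \int[V]_(p in Gr m C) f p)%E.
Proof.
apply: (integral_eq_off_null (measurableC mGrC)); first by case: VC.
move=> p /contrapT pC; rewrite !patchE !mem_set//; exact: GrCT.
Qed.

Lemma integral_varifold_setT : integral_varifold m C V -> integral_varifold m setT V.
Proof.
move=> [_ [M [theta [MC rM theta0 int_theta VE]]]]; split; first exact: varifold_setT.
exists M, theta; split => // K cK _.
(* As [M] lies in [C], the compact set [K] may be cut down to [C], where local integrability of
   [theta] is given. *)
have -> : M `&` K = M `&` (K `&` C).
  by apply/seteqP; split => x [Mx]; [split => //; split => //; exact: MC|case].
apply: int_theta; last exact: subIsetr.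
apply: (subclosed_compact _ cC (@subIsetr _ _ _)).
by apply: closedI => //; exact: compact_closed (@norm_hausdorff _ _) cK.
Qed.

Lemma in_L1_compact (K : set X) B : in_L1 V (Gr m C) B -> compact K -> in_L1 V K B.
Proof.
move=> BL1 cK i j k; have [g [ig Bg]] := BL1 i j k.
have mK : measurable (K : set (borel X)).
  by apply: measurable_closed; exact: compact_closed (@norm_hausdorff _ _) cK.
(* [K] may leave [Gr m C], where [g] is uncontrolled; the representative is set to zero there, on a
   null set. *)
exists (g \_ (Gr m C)); split.
  apply: (@integrableS _ _ _ V setT) => //.
  rewrite (_ : (fun p => _) = (EFin \o g) \_ (Gr m C)); last first.
    by apply/funext => p; rewrite !patchE; case: ifP.
  exact/(integrable_mkcond _ mGrC).
have nullC : V.-negligible (~` Gr m C).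
  by exists (~` Gr m C); split => //; [exact: measurableC|case: VC].
apply: negligibleS (negligibleU Bg nullC) => p /= /not_implyP[_ Bgp].
have [Gp|Gp] := pselect (Gr m C p); [left|by right] => /(_ Gp) Bp.
by apply: Bgp; rewrite patchE mem_set.
Qed.

End varifolds_on_a_compact_set.

Theorem lemma8p4 (R : realType) (n m : nat) (hn : (2 <= n)%N)
    (hm : (1 <= m <= n)%N)
    (Omega : set 'rV[R]_n.+1) (hOmega : C2_domain Omega)
    (hbounded : bounded_set Omega)
    (beta : 'rV[R]_n.+1 -> R)
    (hbeta : C1_hypersurface (frontier Omega) beta)
    (hbeta_range : forall x, frontier Omega x -> 0 < beta x < pi)
    (V : {measure set (borel ('rV[R]_n.+1 * 'M[R]_n.+1)%type) -> \bar R})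
    (B : 'rV[R]_n.+1 * 'M[R]_n.+1 ->
         {bilinear 'rV[R]_n.+1 -> 'rV[R]_n.+1 -> 'rV[R]_n.+1})
    (Gamma : {measure set (borel ('rV[R]_n.+1 * 'M[R]_n.+1)%type) -> \bar R})
    (hCV : capillary_curvature_varifold m Omega beta V B Gamma)
    (hIV : integral_varifold m (closure Omega) V) :
  curvature_varifold_with_boundary m setT V B
    (conormal_measure m Omega beta Gamma) /\
  forall A : set ('rV[R]_n.+1 * 'M[R]_n.+1),
    measurable (A : set (borel ('rV[R]_n.+1 * 'M[R]_n.+1)%type)) ->
    A `<=` Gr m setT ->
    vector_total_variation (Gr m setT) (conormal_measure m Omega beta Gamma) A
    = Gamma A.
Proof.
have [hV hB hGamma hident] := hCV.
have cO : compact (closure Omega) by exact: compact_closure.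
split; last first.
  by move=> A mA AG; exact: vector_total_variation_conormal_measure.
split.
- exact: openT.
- exact: integral_varifold_setT cO hV hIV.
- by move=> K cK _; exact: in_L1_compact hB cK.
- exact: vector_radon_on_conormal_measure.
- move=> phi Cphi _ _.
  (* The left side is brought back to [closure Omega], the capillary identity is applied to [phi],
     and its boundary term is recognised as integration against the conormal measure. *)
  rewrite (integral_Gr_setT cO hV) hident// vector_integral_conormal_measure// => p.
  by apply: differentiable_continuous; exact: Cphi.1.
Qed.
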